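(* Let $S\subseteq[m]\times[n]$ be such that the $2$-way quasi-independence model $\mathcal{M}=\mathcal{M}_S$ has rational maximum likelihood estimator (i.e. ML-degree $1$), and let $I\subset\mathbb{C}[x_s\mid s\in S]$ be its toric vanishing ideal. Then: (1) The model $\mathcal{M}$ has an $\mathcal{A}$-matrix that realizes $\mathcal{M}$ as a coordinate toric fiber product along each of its internal coordinates. (2) The ideal $I$ can be realized as an iterated toric fiber product of linear ideals.
   Context: **Models.** For an integer matrix $\mathcal{A}$ with columns indexed by a finite set $S$ and with the all-ones vector in its row span, the log-linear model is $\mathcal{M}_{\mathcal{A}}=\{p\in\Delta_{\#S-1}: p>0,\ \log p\in\mathrm{rowspan}(\mathcal{A})\}$, where $\Delta_{\#S-1}$ is the probability simplex in $\mathbb{R}^S$. Its toric vanishing ideal is $I_{\mathcal{A}}=\langle x^u-x^v : u,v\in\mathbb{N}^S,\ u-v\in\ker_{\mathbb{Z}}\mathcal{A}\rangle$. For $S\subseteq[m_1]\times\dots\times[m_k]$, the $k$-way quasi-independence model $\mathcal{M}_S$ is the log-linear model of the $0/1$ matrix $\mathcal{A}_S$ with columns indexed by $S$ and with $k$ blocks of rows, the $j$th block having rows indexed by $[m_j]$, where the column of $(i_1,\dots,i_k)$ has in block $j$ a single $1$, in row $i_j$. An $\mathcal{A}$-matrix of $\mathcal{M}_S$ is a matrix with columns indexed by $S$ and with the same row span as $\mathcal{A}_S$. **ML-degree.** The ML-degree of a model is the number of complex critical points, counted with multiplicity, of the log-likelihood function $\sum_s u_s\log p_s$ for generic data $u$,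 on the locus of points with nonzero coordinates and $\sum_s p_s=1$ of the Zariski closure of the model. For log-linear models this is the number of such points $p$ satisfying $\mathcal{A}u=u_+\mathcal{A}p$, where $u_+=\sum_s u_s$. ML-degree $1$ is equivalent to the MLE being a rational function of the data. **Multipartition matrices.** A partition matrix is a $0/1$ matrix in which every column has exactly one entry equal to $1$. A multipartition matrix is a vertical stack of partition matrices $\mathcal{B}_0,\dots,\mathcal{B}_h$ (its blocks). Repeated columns are allowed. Each column corresponds to a tuple $(c_0,\dots,c_h)$, where $c_r$ is the label of the row of $\mathcal{B}_r$ in which that column has its $1$. Internal coordinates are the indices $r\in\{1,\dots,h-1\}$. **Coordinate toric fiber product (cTFP).** A multipartition matrix with blocks $\mathcal{B}_0,\dots,\mathcal{B}_h$ and set of column tuples $\bar S$ is a cTFP along the internal coordinate $r$ if $\bar S$ consists of all concatenations $(c_0,\dots,c_{r-1},x,d_{r+1},\dots,d_h)$ such that $(c_0,\dots,c_{r-1},x)$ is the initial part of some element of $\bar S$ and $(x,d_{r+1},\dots,d_h)$ is the final part of some element of $\bar S$ with the same $r$th coordinate $x$. **Toric fiber product of matrices.** Let $X,Y$ be integer matrices whose columns are partitioned into classes $X=\bigsqcup_{c}G_c$ and $Y=\bigsqcup_c H_c$ indexed by a common finite set. Give the variable of each column in $G_c$ (resp. $H_c$) the multidegree $e_c$, where the $e_c$ are standard basis vectors. If the toric ideals $I_X$ and $I_Y$ are homogeneous with respect to these multigradings, the toric fiber product of $X$ and $Y$ with respect to the partitions is the matrix whose columns, as a multiset, are all vertical concatenations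 of a column in $G_c$ with a column in $H_c$, over all $c$. Its toric ideal is the toric fiber product of $I_X$ and $I_Y$. **Iterated toric fiber product of linear ideals.** Let $\bar{\mathcal{A}}$ be a multipartition matrix with blocks $\mathcal{B}_0,\dots,\mathcal{B}_h$, and let $\bar{\mathcal{A}}^{r}$ be the multipartition matrix with blocks $\mathcal{B}_0,\dots,\mathcal{B}_r$. $\bar{\mathcal{A}}$ is an iterated toric fiber product of linear ideals if for each $r\in\{0,\dots,h-1\}$ there are matrices $X$ and $Y$ such that the columns of $X$ are a sub-multiset of those of $\bar{\mathcal{A}}^{r}$, the columns of $Y$ are a sub-multiset of those of $\mathcal{B}_{r+1}$, and $\bar{\mathcal{A}}^{r+1}$ is a toric fiber product of $X$ and $Y$. The toric ideal of a matrix whose columns are columns of a single partition matrix is generated by linear forms. An ideal $I$ is realized as an iterated toric fiber product of linear ideals if $I=I_{\bar{\mathcal{A}}}$ for such an $\bar{\mathcal{A}}$ with columns indexed by $S$. *)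

(* Defs.v *)
From HB Require Import structures.
From mathcomp Require Import all_boot all_order all_algebra.
From mathcomp Require Import complex reals.
From mathcomp Require Import mpoly.

Set Implicit Arguments.
Unset Strict Implicit.
Unset Printing Implicit Defensive.

Import Order.TTheory GRing.Theory Num.Theory.
Local Open Scope ring_scope.

(* Columns indexed by a finite set S are indexed by 'I_#|S| through enum_val;
   the variable x_s of C[x_s | s in S] is then 'X_i with s = enum_val i. *)

Section PolynomialIdeals.
Variables (C : fieldType) (N : nat).
Local Notation poly := {mpoly C[N]}.

Definition gen_ideal (G : poly -> Prop) (f : poly) : Prop :=
  exists l : seq (poly * poly),
    (forall q, q \in l -> G q.2) /\ f = \sum_(q <- l) q.1 * q.2.

Definition quotient_dim (J : poly -> Prop) (d : nat) : Prop :=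
  exists b : 'I_d -> poly,
    (forall f, exists a : 'I_d -> C, J (f - \sum_i a i *: b i)) /\
    (forall a : 'I_d -> C, J (\sum_i a i *: b i) -> forall i, a i = 0).

Definition eval (f : poly) (p : 'cV[C]_N) : C := f.@[fun s => p s 0].

(* Preimage in C[x] of the extension of J to the local ring C[x]_p. *)
Definition localized_ideal (J : poly -> Prop) (p : 'cV[C]_N) (f : poly) :=
  exists g : poly, eval g p != 0 /\ J (g * f).

(* The multiplicity of p is the length of (C[x]/J)_p.  If p is isolated, the
   elements of C[x] that do not vanish at p are already invertible modulo
   localized_ideal J p, so that (C[x]/J)_p is the quotient used here. *)
Definition multiplicity (J : poly -> Prop) (p : 'cV[C]_N) (d : nat) : Prop :=
  quotient_dim (localized_ideal J p) d.

Definition multidegree c (g : 'I_N -> 'I_c) (u : 'X_{1..N})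
    : {ffun 'I_c -> nat} :=
  [ffun a => (\sum_(s < N | g s == a) u s)%N].

Definition multigraded_part c (g : 'I_N -> 'I_c) (a : {ffun 'I_c -> nat})
    (f : poly) : poly :=
  \sum_(u <- msupp f | multidegree g u == a) f@_u *: 'X_[u].

Definition homogeneous_ideal c (g : 'I_N -> 'I_c) (J : poly -> Prop) : Prop :=
  forall f a, J f -> J (multigraded_part g a f).

End PolynomialIdeals.

Section LogLinearModels.
Variables (C : fieldType) (d N : nat) (A : 'M[int]_(d, N)).

Definition toric_ideal : {mpoly C[N]} -> Prop :=
  gen_ideal (fun f => exists u v : 'X_{1..N},
    (forall i, \sum_s A i s * ((u s)%:Z - (v s)%:Z) = 0) /\
    f = 'X_[u] - 'X_[v]).

Definition total (u : 'cV[C]_N) : C := \sum_s u s 0.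

Local Notation AC := (map_mx intr A : 'M[C]_(d, N)).

(* The last clause is the critical equation of \sum_s u_s log p_s on the points
   of the Zariski closure with nonzero coordinates of sum 1. *)
Definition critical_point (u p : 'cV[C]_N) : Prop :=
  [/\ forall s, p s 0 != 0,
      total p = 1,
      forall f, toric_ideal f -> eval f p = 0 &
      AC *m u = total u *: (AC *m p)].

Definition likelihood_ideal (u : 'cV[C]_N) : {mpoly C[N]} -> Prop :=
  gen_ideal (fun f =>
    [\/ toric_ideal f,
        f = (\sum_s 'X_s) - 1 |
        exists i, f = \sum_s (A i s)%:~R * (total u *: 'X_s - (u s 0)%:MP)]).

(* Data are generic when they avoid the zero locus of a nonzero polynomial. *)
Definition ml_degree (D : nat) : Prop :=
  exists g : {mpoly C[N]}, g != 0 /\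
    forall u : 'cV[C]_N, eval g u != 0 ->
      exists (ps : seq 'cV[C]_N) (mu : 'cV[C]_N -> nat),
        [/\ uniq ps,
            forall p, p \in ps <-> critical_point u p,
            forall p, p \in ps -> multiplicity (likelihood_ideal u) p (mu p) &
            (\sum_(p <- ps) mu p = D)%N].

End LogLinearModels.

Arguments toric_ideal C {d N} A _.
Arguments ml_degree C {d N} A D.

Definition same_row_span (R : fieldType) d e N
    (A : 'M[int]_(d, N)) (B : 'M[int]_(e, N)) : Prop :=
  (map_mx intr A :=: (map_mx intr B : 'M[R]_(e, N)))%MS.

Arguments same_row_span R {d e N} A B.

Definition quasi_independence_mx m n (S : {set 'I_m * 'I_n})
    : 'M[int]_(m + n, #|S|) :=
  col_mx (\matrix_(i < m, s < #|S|) ((enum_val s).1 == i)%:R)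
         (\matrix_(j < n, s < #|S|) ((enum_val s).2 == j)%:R).

Definition partition_mx k N (B : 'M[int]_(k, N)) : Prop :=
  (forall i s, B i s = 0 \/ B i s = 1) /\
  (forall s, #|[set i | B i s == 1]| = 1%N).

(* A family of blocks is indexed by nat so that the matrix with blocks
   B 0, ..., B r is defined for each r; a multipartition matrix with blocks
   B 0, ..., B h does not involve B r for r > h. *)
Section MultipartitionMatrices.
Variables (N : nat) (k : nat -> nat) (B : forall r, 'M[int]_(k r, N)).

Fixpoint stack_rows (r : nat) : nat :=
  if r is r'.+1 then (stack_rows r' + k r'.+1)%N else k 0.

Fixpoint stack (r : nat) : 'M[int]_(stack_rows r, N) :=
  match r return 'M[int]_(stack_rows r, N) with
  | 0 => B 0
  | r'.+1 => col_mx (stack r') (B r'.+1)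
  end.

Definition multipartition (h : nat) : Prop :=
  forall r, (r <= h)%N -> partition_mx (B r).

Definition column_tuple (h : nat) (c : forall r : 'I_h.+1, 'I_(k r)) : Prop :=
  exists s : 'I_N, forall r : 'I_h.+1, B r (c r) s = 1.

Definition internal (h : nat) (r : 'I_h.+1) : bool := (0 < r < h)%N.

Definition cTFP (h : nat) (r : 'I_h.+1) : Prop :=
  forall t : forall q : 'I_h.+1, 'I_(k q),
    column_tuple t <->
    exists c d : forall q : 'I_h.+1, 'I_(k q),
      [/\ column_tuple c, column_tuple d, c r = d r,
          forall q : 'I_h.+1, (q <= r)%N -> t q = c q &
          forall q : 'I_h.+1, (r <= q)%N -> t q = d q].

End MultipartitionMatrices.

Definition columns d N (A : 'M[int]_(d, N)) : seq 'cV[int]_d :=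
  [seq col s A | s <- enum 'I_N].

Definition sub_columns d M N (X : 'M[int]_(d, M)) (A : 'M[int]_(d, N)) : Prop :=
  forall v : 'cV[int]_d,
    (count_mem v (columns X) <= count_mem v (columns A))%N.

(* The class of the column a of X is gX a, and that of the column b of Y is
   gY b. *)
Definition toric_fiber_product (C : fieldType) d e M N P c
    (X : 'M[int]_(d, M)) (gX : 'I_M -> 'I_c)
    (Y : 'M[int]_(e, N)) (gY : 'I_N -> 'I_c)
    (Z : 'M[int]_(d + e, P)) : Prop :=
  [/\ homogeneous_ideal gX (toric_ideal C X),
      homogeneous_ideal gY (toric_ideal C Y) &
      perm_eq (columns Z)
        [seq col_mx (col ab.1 X) (col ab.2 Y)
          | ab <- enum {: 'I_M * 'I_N} & gX ab.1 == gY ab.2]].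

Definition iterated_TFP_linear (C : fieldType) N (k : nat -> nat)
    (B : forall r, 'M[int]_(k r, N)) (h : nat) : Prop :=
  forall r, (r < h)%N ->
    exists (M M' c : nat) (X : 'M[int]_(stack_rows k r, M))
           (Y : 'M[int]_(k r.+1, M')) (gX : 'I_M -> 'I_c) (gY : 'I_M' -> 'I_c),
      [/\ sub_columns X (stack B r),
          sub_columns Y (B r.+1) &
          toric_fiber_product C X gX Y gY (stack B r.+1)].

(* Main.v *)
Require Import Defs.
From HB Require Import structures.
From mathcomp Require Import all_boot all_order all_algebra.
From mathcomp Require Import complex reals.
From mathcomp Require Import mpoly.
From mathcomp Require Import ring lra zify.
From mathcomp Require boolp.
From mathcomp Require classical_sets topology normedtype derive realfun.

Set Implicit Arguments.
Unset Strict Implicit.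
Unset Printing Implicit Defensive.

Import Order.TTheory GRing.Theory Num.Theory.
Local Open Scope ring_scope.

(* Write N i for the set of columns j with (i, j) in S.  The first part holds
   for every S: the blocks "constant, rows, columns" have a single internal
   coordinate, and gluing along the row coordinate is then vacuous.

   For the second part, put p = x_i y_j and eliminate the x_i.  Critical points
   become critical points of prod_j y_j^(c_j) / prod_i l_i(y)^(r_i), where
   l_i(y) is the sum of y_j over N i, on the complement of a real hyperplane
   arrangement.  The data can be chosen, generically, with all c_j > 0 and with
   r_i < 0 except at one root row of a connected component; in the chart where
   the root form equals 1 the function is then a positive-exponent product of
   linear forms, and each bounded region contains a critical point.  So ML-degree
   1 forces uniqueness of the bounded region.  If K is the column set of a
   connected set of rows, and two rows meeting K share a column a outside K, then
   the line arrangement {0, -A, -B} in the coordinate y_a, with A and B the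
   values of the two row forms at a generic point on K, has two bounded intervals
   unless the two rows agree on K (the exchange property).

   The exchange property yields a row or column with a single cell, or twin rows
   or columns, and it is inherited by restrictions, so S is built from the empty
   set by adding free points and duplicating rows and columns.  Iterated toric
   fiber products follow these steps: a free point gets a new label in every
   block, and a duplicated row gets one more block. *)

(** * Critical points of products of linear forms *)

Section AnalyticCenter.
Import -(notations) boolp classical_sets topology normedtype derive realfun.
Import numFieldNormedType.Exports.
Lemma deriv_local_max (R : realType) (q : {poly R}) (e : R) :
  0 < e -> (forall t, `|t| < e -> q.[t] <= q.[0]) -> q^`().[0] = 0.
Proof.
move=> e0 qmax.
have inI t : t \in `]- e, e[ -> `|t| < e.
  by rewrite in_itv /= ltr_norml.
have d0 : is_derive (0 : R) (1 : R) (horner q) 0.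
  apply: (@derive1_at_max R (horner q) (- e) e 0).
  - by rewrite ge0_cp // ltW.
  - by move=> t _; have [] := is_derive_poly q t.
  - by rewrite in_itv /= oppr_lt0 e0.
  - by move=> t /inI /qmax.
by rewrite -(@derive_val _ _ _ _ _ _ _ (is_derive_poly q 0)) (@derive_val _ _ _ _ _ _ _ d0).
Qed.

Variables (R : realType) (n : nat).
Implicit Types a y d : 'I_n -> R.

Definition lin a y : R := \sum_j a j * y j.

Lemma lin_continuous a : continuous (fun y : 'rV[R]_n => lin a (fun j => y 0 j)).
Proof.
rewrite /lin; apply: continuous_big => [|j _]; first exact: add_continuous.
move=> y; apply: continuousM; first exact: cst_continuous.
exact: (@coord_continuous R 1 n 0 j y).
Qed.

Lemma lin_prod_continuous (F : finType) (P : pred F) (a : F -> 'I_n -> R)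
    (e : F -> nat) :
  continuous (fun y : 'rV[R]_n =>
    \prod_(f | P f) lin (a f) (fun j => y 0 j) ^+ e f).
Proof.
apply: continuous_big => [|f _]; first exact: mul_continuous.
move=> y; apply: (@continuous_comp _ _ _ (fun y : 'rV[R]_n => lin (a f) (fun j => y 0 j)) (fun x => x ^+ e f)).
  exact: lin_continuous.
exact: exprn_continuous.
Qed.


Lemma linD a y d t : lin a (fun j => y j + t * d j) = lin a y + t * lin a d.
Proof.
rewrite /lin mulr_sumr -big_split /=; apply: eq_bigr => j _.
by rewrite mulrDr mulrCA.
Qed.

Lemma lin_line_eventually (F : finType) (P : pred F) (a : F -> 'I_n -> R) y d :
  (forall f, P f -> 0 < lin (a f) y) ->
  exists2 t0, 0 < t0 & forall t, `|t| < t0 ->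
    forall f, P f -> 0 < lin (a f) (fun j => y j + t * d j).
Proof.
move=> y0.
pose b f := lin (a f) y / (1 + `|lin (a f) d|).
exists (\big[Num.min/1]_(f | P f) b f).
  apply/bigmin_gtP; split=> // f /y0 fy.
  by rewrite divr_gt0 // ltr_wpDr.
move=> t /bigmin_gtP[_ tb] f Pf; rewrite linD.
have := tb f Pf; rewrite /b ltr_pdivlMr; last by rewrite ltr_wpDr.
rewrite mulrDr mulr1 => tf.
have : - (t * lin (a f) d) <= `|t| * `|lin (a f) d|.
  by rewrite -normrM -normrN ler_norm.
have := normr_ge0 t; lra.
Qed.

Lemma deriv_lin_prod (F : Type) (r : seq F) (P : pred F) (al be : F -> R)
    (e : F -> nat) :
  (forall f, P f -> al f != 0) ->
  (\prod_(f <- r | P f) ((al f)%:P + be f *: 'X) ^+ e f)^`().[0] =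
  (\prod_(f <- r | P f) al f ^+ e f) *
    \sum_(f <- r | P f) (e f)%:R * be f / al f.
Proof.
move=> al0; elim: r => [|f s IH].
  by rewrite !big_nil derivC hornerC mulr0.
rewrite !big_cons; case: ifP => // Pf.
rewrite derivM hornerD !hornerM IH deriv_exp hornerMn hornerM.
rewrite derivD derivC derivZ derivX add0r !hornerE horner_prod.
under eq_bigr do rewrite !hornerE.
rewrite /=.
have al0f := al0 f Pf.
case: (e f) => [|k]; first by rewrite !expr0 mulr0n !mul0r !mul1r !add0r.
rewrite /= exprS -mulr_natr; field; exact: al0f.
Qed.

(** The bound makes the polyhedron given by the equations [c k] and the inequalities
    [0 <= lin (a f) y] compact, so the product of powers attains a maximum on it. The product is
    positive at [y0] and vanishes on every wall, so the maximizer is interior and the logarithmic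
    derivative vanishes along all directions tangent to the equations. *)
Lemma positive_critical_point (F : finType) (P : pred F) (a : F -> 'I_n -> R)
    (e : F -> nat) (K : finType) (c : K -> 'I_n -> R) (y0 : 'I_n -> R) (B : R) :
  (forall f, P f -> 0 < lin (a f) y0) -> (forall f, P f -> (0 < e f)%N) ->
  (forall y, (forall k, lin (c k) y = lin (c k) y0) ->
     (forall f, P f -> 0 <= lin (a f) y) -> forall j, `|y j| <= B) ->
  exists y : 'I_n -> R, [/\ forall k, lin (c k) y = lin (c k) y0,
    forall f, P f -> 0 < lin (a f) y &
    forall d, (forall k, lin (c k) d = 0) ->
      \sum_(f | P f) (e f)%:R * lin (a f) d / lin (a f) y = 0].
Proof.
move=> a0 e0 bdd.
pose fn (y : 'rV[R]_n) j := y 0 j.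
pose A : set 'rV[R]_n := fun z => (forall k, lin (c k) (fn z) = lin (c k) y0) /\
   (forall f, P f -> 0 <= lin (a f) (fn z)).
pose phi (y : 'rV[R]_n) := \prod_(f | P f) lin (a f) (fn y) ^+ e f.
have fnrow y : fn (\row_j y j) = y by apply/funext=> j; rewrite /fn mxE.
have Ay0 : A (\row_j y0 j) by rewrite /A fnrow; split=> // f /a0/ltW.
have Acl : closed A.
  have -> : A = setI
      (bigcap (fun k => True) (fun k z => lin (c k) (fn z) = lin (c k) y0))
      (bigcap (fun f => P f) (fun f z => 0 <= lin (a f) (fn z))).
    by apply/seteqP; split=> z [H1 H2]; split=> // k; exact: H1.
  apply: closedI; apply: closed_bigI => f _.
    exact: (preimage_closed (fun z _ => @lin_continuous (c f) z) (closed_eq (y := _))).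
  exact: (preimage_closed (fun z _ => @lin_continuous (a f) z) (closed_ge (y := _))).
have Acpt : compact A.
  apply: bounded_closed_compact => //.
  exists `|B|; split=> [|x Bx z [Az1 Az2]]; first exact: num_real.
  suff: mx_norm z <= x by [].
  rewrite mx_normrE; apply/bigmax_leP; split=> [|[i j] _].
    exact: le_trans (ltW Bx).
  rewrite ord1; apply: le_trans (bdd _ Az1 Az2 j) (le_trans _ (ltW Bx)).
  exact: ler_norm.
have [y /set_mem Ay ymax] : exists2 y, y \in A & forall z, z \in A -> phi z <= phi y.
  apply: EVT_max_rV => //; first by exists (\row_j y0 j).
  by apply: continuous_subspaceT; exact: lin_prod_continuous.
have ypos f : P f -> 0 < lin (a f) (fn y).
  move=> Pf; rewrite lt0r (Ay.2 f Pf) andbT; apply/eqP=> fy0.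
  have := ymax _ (mem_set Ay0); rewrite {2}/phi (bigD1 f) //= fy0 expr0n gtn_eqF ?e0 //.
  rewrite mul0r /phi fnrow; apply/negP; rewrite -ltNge.
  by apply: prodr_gt0 => g /a0 ?; rewrite exprn_gt0.
exists (fn y); split=> //; first exact: Ay.1.
move=> d d0.
have [t0 t0gt line] := lin_line_eventually d ypos.
pose q := \prod_(f | P f) ((lin (a f) (fn y))%:P + lin (a f) d *: 'X) ^+ e f.
have qE t : q.[t] = phi (\row_j (fn y j + t * d j)).
  rewrite /phi /q horner_prod; apply: eq_bigr => f _.
  by rewrite !hornerE fnrow linD [in RHS]mulrC.
have : q^`().[0] = 0.
  apply: (deriv_local_max t0gt) => t /line tpos; rewrite !qE.
  rewrite [X in _ <= phi X](_ : _ = y); last first.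
    by apply/rowP=> j; rewrite mxE mul0r addr0.
  apply: ymax; apply: mem_set; split=> [k|f Pf]; rewrite fnrow.
    by rewrite linD d0 mulr0 addr0 Ay.1.
  exact/ltW/tpos.
rewrite deriv_lin_prod => [/eqP|f Pf]; last by rewrite gt_eqF ?ypos.
rewrite mulf_eq0 => /orP[/prodf_eq0[f Pf]|/eqP//].
by rewrite expf_eq0 gt_eqF ?ypos // andbF.
Qed.

End AnalyticCenter.
(** * Bounded regions of the arrangement of a quasi-independence model *)

(** Finitely many pairs admit a common small [t], which then acts as an infinitesimal: signs are
    read off lexicographically. *)
Lemma small_perturb (R : realFieldType) (F : finType) (al be : F -> R) :
  exists2 t, 0 < t & forall f,
    Num.sg (al f + t * be f) = if al f == 0 then Num.sg (be f) else Num.sg (al f).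
Proof.
pose b f := if al f == 0 then 1 else `|al f| / (1 + `|be f|).
pose t : R := 2^-1 * \big[Num.min/1]_f b f.
have t0 : 0 < t.
  rewrite mulr_gt0 ?invr_gt0 ?ltr0n //; apply/bigmin_gtP; split=> // f _.
  rewrite /b; case: eqP => // /eqP f0.
  by rewrite divr_gt0 ?normr_gt0 // ltr_wpDr.
exists t => // f; case: eqP => [->|/eqP f0]; first by rewrite add0r sgrM gtr0_sg ?mul1r.
have tb : t < b f.
  have: \big[Num.min/1]_g b g <= b f by apply: bigmin_le.
  by rewrite /t; move: t0; rewrite /t; lra.
move: tb; rewrite /b (negPf f0) ltr_pdivlMr; last by rewrite ltr_wpDr.
rewrite mulrDr mulr1 => tb.
have tf : `|t * be f| < `|al f|.
  by rewrite normrM gtr0_norm //; lra.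
move: tf; rewrite ltr_norml => /andP[lo hi].
case: (ltrgt0P (al f)) f0 lo hi => [a0|a0|->]; rewrite ?eqxx // => _ lo hi.
  by rewrite !gtr0_sg //; move: lo; rewrite ?gtr0_norm //; lra.
by rewrite !ltr0_sg //; move: hi; rewrite ?ltr0_norm //; lra.
Qed.

(** Each point of [s] beyond the left end pulls the right end in, so that a whole subinterval
    survives. *)
Lemma itv_avoid (R : realFieldType) (s : seq R) (p q : R) :
  p < q -> exists v, [/\ p < v, v < q & v \notin s].
Proof.
move=> pq; have [p' [q' [pp qq pq' av]]] : exists p' q', [/\ p <= p', q' <= q, p' < q' &
    forall v, p' < v -> v < q' -> v \notin s].
  elim: s => [|x s [p' [q' [pp qq pq' av]]]]; first by exists p, q.
  have [xp|xp] := leP x p'; last first.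
    exists p', (Num.min x q'); split=> //; first by rewrite ge_min qq orbT.
      by rewrite lt_min xp.
    move=> v pv; rewrite lt_min => /andP[vx vq]; rewrite inE negb_or av // andbT.
    by rewrite lt_eqF.
  exists p', q'; split=> // v pv vq; rewrite inE negb_or av // andbT gt_eqF //.
  exact: le_lt_trans xp pv.
exists ((p' + q') / 2); have [p2 q2] := midf_lt pq'; split; last exact: av.
  exact: le_lt_trans pp p2.
exact: lt_le_trans q2 qq.
Qed.

Section Arrangement.
Variables (R : realType) (I : finType) (n : nat) (N : I -> {set 'I_n}).
Implicit Types (K D : {set 'I_n}) (y z : 'I_n -> R) (i : I) (j : 'I_n).

Definition meets K i := N i :&: K != set0.

Definition closed_cols D := [forall i, meets D i ==> (N i \subset D)].

(** The columns of the connected components of the bipartite graph that meet [K]. *)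
Definition cl K := \bigcap_(D : {set 'I_n} | closed_cols D && (K \subset D)) D.

(** The column sets of connected collections of rows containing [i0]. *)
Inductive span i0 : {set 'I_n} -> Prop :=
| span_row : span i0 (N i0)
| span_step K i : span i0 K -> meets K i -> span i0 (K :|: N i).

Definition ell y i : R := \sum_(j in N i) y j.

(* In the chart ell z i0 = 1, the points z having the sign pattern of y have
   bounded coordinates on a pinned set: if those on K are bounded and the new
   coordinates of row i all have the sign opposite to that of the form of row i,
   then they cannot be large. *)
Inductive pinned i0 y : {set 'I_n} -> Prop :=
| pinned_row : pinned i0 y (N i0)
| pinned_step K i : pinned i0 y K ->
    (forall j, j \in N i :\: K -> y j * ell y i < 0) -> pinned i0 y (K :|: N i).

Definition generic y K :=
  (forall j, (y j != 0) = (j \in K)) /\ (forall i, meets K i -> ell y i != 0).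

(** A bounded region is represented by one of its points: genericity keeps the point off the
    hyperplanes, pinning bounds the region, and positivity on the root row fits the chart where the
    root form is 1. *)
Definition region i0 y K :=
  [/\ generic y K, pinned i0 y K & forall j, j \in N i0 -> 0 < y j].

Definition same_signs y z K :=
  (forall j, j \in K -> Num.sg (z j) = Num.sg (y j)) /\
  (forall i, meets K i -> Num.sg (ell z i) = Num.sg (ell y i)).

Lemma cl_closed K : closed_cols (cl K).
Proof.
apply/forallP=> i; apply/implyP=> /set0Pn[j /setIP[jN /bigcapP jK]].
apply/bigcapsP=> D /andP[cD KD]; have jD := jK D; rewrite cD KD in jD.
move/forallP/(_ i)/implyP: cD; apply; apply/set0Pn; exists j.
by rewrite inE jN jD.
Qed.

Lemma sub_cl K : K \subset cl K.
Proof. by apply/bigcapsP=> D /andP[]. Qed.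

Lemma cl_min K D : closed_cols D -> K \subset D -> cl K \subset D.
Proof. by move=> cD KD; apply: bigcap_inf; rewrite cD. Qed.

Lemma meetsS K D i : K \subset D -> meets K i -> meets D i.
Proof.
move=> KD /set0Pn[j /setIP[ji jK]]; apply/set0Pn; exists j.
by rewrite inE ji (subsetP KD).
Qed.

Lemma cl_step K i : meets K i -> cl (K :|: N i) = cl K.
Proof.
move=> iK; apply/eqP; rewrite eqEsubset; apply/andP; split; apply: cl_min;
  rewrite ?cl_closed //; last first.
  exact: subset_trans (subsetUl _ _) (sub_cl _).
rewrite subUset sub_cl; move/forallP/(_ i)/implyP: (cl_closed K); apply.
exact: meetsS (sub_cl K) iK.
Qed.

Lemma cl_span i0 K : span i0 K -> cl K = cl (N i0).
Proof. by elim=> // {}K i _ IH /cl_step->. Qed.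

Lemma ell0 y i : (forall j, j \in N i -> y j = 0) -> ell y i = 0.
Proof. by move=> y0; apply: big1. Qed.

Lemma ellD y z t i : ell (fun j => y j + t * z j) i = ell y i + t * ell z i.
Proof. by rewrite /ell big_split /= -mulr_sumr. Qed.

Lemma meets_sg K y z i :
  (forall i, meets K i -> Num.sg (ell z i) = Num.sg (ell y i)) ->
  N i \subset K -> Num.sg (ell z i) = Num.sg (ell y i).
Proof.
move=> sgE NK; have [iK|] := boolP (meets K i); first exact: sgE.
rewrite negbK (setIidPl NK) => /eqP N0.
by rewrite !ell0 // => j; rewrite N0 inE.
Qed.

Lemma same_signs_sub y z K D : K \subset D -> same_signs y z D -> same_signs y z K.
Proof.
move=> KD [s1 s2]; split=> [j jK|i iK]; first by rewrite s1 ?(subsetP KD).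
by rewrite s2 // (meetsS KD).
Qed.

Lemma same_signs_trans y z w K :
  same_signs y z K -> same_signs z w K -> same_signs y w K.
Proof.
move=> [s1 s2] [t1 t2]; split=> [j jK|i iK]; first by rewrite t1 // s1.
by rewrite t2 // s2.
Qed.

Lemma pinned_sg i0 y z K : pinned i0 y K ->
  (forall j, j \in K -> Num.sg (z j) = Num.sg (y j)) ->
  (forall i, N i \subset K -> Num.sg (ell z i) = Num.sg (ell y i)) -> pinned i0 z K.
Proof.
elim=> [_ _|{}K i _ IH neg s1 s2]; first exact: pinned_row.
apply: pinned_step => [|j jN].
  apply: IH => [j jK|k kK]; first by rewrite s1 // inE jK.
  by rewrite s2 // (subset_trans kK) ?subsetUl.
have jN' := jN; move: jN'; rewrite inE => /andP[jK jN'].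
by rewrite -sgr_lt0 sgrM s1 ?inE ?jN' ?orbT // s2 ?subsetUr // -sgrM sgr_lt0 neg.
Qed.

Lemma pinned_same_signs i0 y z K : pinned i0 y K -> same_signs y z K -> pinned i0 z K.
Proof.
move=> dety [s1 s2]; apply: pinned_sg dety s1 _ => i; exact: meets_sg.
Qed.

Lemma generic_same_signs y z K :
  generic y K -> (forall j, j \notin K -> z j = 0) -> same_signs y z K -> generic z K.
Proof.
move=> [a1 a2] z0 [s1 s2]; split=> [j|i iK]; last by rewrite -sgr_eq0 s2 // sgr_eq0 a2.
have [jK|jK] := boolP (j \in K); last by rewrite z0 ?eqxx.
by rewrite -sgr_eq0 s1 // sgr_eq0 a1.
Qed.

Lemma generic0 y K j : generic y K -> j \notin K -> y j = 0.
Proof. by case=> <- _; rewrite negbK => /eqP. Qed.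

(** The columns of row [i] outside [K1] receive infinitesimal values of sign opposite to the form of
    row [i]. That form keeps its sign, so row [i] pins all its columns outside [K]. The set [K1]
    leaves room for new columns that already have finite values. *)
Lemma region_extend i0 i y K K1 : K \subset K1 -> K1 \subset K :|: N i ->
  generic y K1 -> pinned i0 y K -> meets K i -> (forall j, j \in N i0 -> 0 < y j) ->
  N i0 \subset K ->
  (forall j, j \in K1 :\: K -> y j * ell y i < 0) ->
  exists2 z, region i0 z (K :|: N i) & same_signs y z K1.
Proof.
move=> KK1 K1N adm1 dety iK pos N0K neg.
pose w j := if j \in N i :\: K1 then - Num.sg (ell y i) else 0.
pose al (f : 'I_n + I) := match f with inl j => y j | inr i => ell y i end.
pose be (f : 'I_n + I) := match f with inl j => w j | inr i => ell w i end.
have [t t0 sgt] := small_perturb al be.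
have [a1 a2] := adm1; have iK1 := meetsS KK1 iK.
pose z j := y j + t * w j.
have sgs : same_signs y z K1.
  split=> [j jK|i' iK'].
    by have := sgt (inl j); rewrite /= -a1 /= in jK *; rewrite (negPf jK).
  by have := sgt (inr i'); rewrite /= -ellD (negPf (a2 _ iK')).
exists z => //.
have sgw j : j \in N i :\: K1 -> Num.sg (z j) = - Num.sg (ell y i).
  move=> jN; have yj : y j = 0 by apply: (generic0 adm1); case/setDP: jN.
  by have := sgt (inl j); rewrite /= -/(z j) yj eqxx /w jN sgrN sgr_id.
split.
- split=> [j|i' iK'].
    rewrite inE; have [jK1|jK1] := boolP (j \in K1).
      rewrite -sgr_eq0 sgs.1 // sgr_eq0 a1 jK1.
      by move/subsetP/(_ j jK1): K1N; rewrite inE => ->.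
    have -> : (j \in K) = false by apply: contraNF jK1; apply: (subsetP KK1).
    have [jN|jN] := boolP (j \in N i).
      by rewrite -sgr_eq0 sgw ?inE ?jK1 // oppr_eq0 sgr_eq0 a2.
    by rewrite /z (generic0 adm1) // /w inE (negPf jN) andbF mulr0 addr0 eqxx.
  have [i'K1|i'K1] := boolP (meets K1 i'); first by rewrite -sgr_eq0 sgs.2 // sgr_eq0 a2.
  (* A row disjoint from [K1] sees only the perturbation, whose nonzero entries all have the same
     sign, so nothing cancels in its form. *)
  have N1 j : j \in N i' -> j \notin K1.
    by move=> jN; apply: contraNN i'K1 => jK; apply/set0Pn; exists j; rewrite inE jN.
  rewrite ellD ell0 ?add0r; last by move=> j /N1 /(generic0 adm1).
  rewrite mulf_eq0 (gt_eqF t0) /=.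
  have -> : ell w i' = \sum_(j in N i' :&: N i) - Num.sg (ell y i).
    rewrite /ell (big_setID (N i)) /= [X in _ + X]big1 ?addr0.
      by apply: eq_bigr => j /setIP[/N1 jK jN]; rewrite /w inE jK jN.
    by move=> j /setDP[_ jN]; rewrite /w inE (negPf jN) andbF.
  rewrite sumr_const mulrn_eq0 negb_or oppr_eq0 sgr_eq0 a2 // andbT cards_eq0.
  case/set0Pn: iK' => j /setIP[jN']; rewrite inE => /orP[jK|jN].
    by have := N1 _ jN'; rewrite (subsetP KK1).
  by apply/set0Pn; exists j; rewrite inE jN'.
- apply: pinned_step => [|j jN].
    apply: pinned_same_signs dety _; exact: same_signs_sub sgs.
  rewrite -sgr_lt0 sgrM sgs.2 //.
  have [jK1|jK1] := boolP (j \in K1).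
    rewrite sgs.1 // -sgrM sgr_lt0 neg // inE jK1 andbT.
    by case/setDP: jN.
  rewrite sgw ?inE ?jK1 //; last by case/setDP: jN.
  by rewrite mulNr -expr2 sqr_sg a2 // oppr_lt0 ltr01.
- move=> j jN; rewrite -sgr_gt0 sgs.1 ?sgr_gt0 ?pos //.
  exact: subsetP (subset_trans N0K KK1) _ jN.
Qed.


Lemma pinned_sub i0 y K : pinned i0 y K -> N i0 \subset K.
Proof. by elim=> // {}K i _ IH _; exact/(subset_trans IH)/subsetUl. Qed.

Lemma region_step i0 i y K : region i0 y K -> meets K i ->
  exists2 z, region i0 z (K :|: N i) & same_signs y z K.
Proof.
move=> [ady dety pos] iK.
apply: (region_extend (subxx K) (subsetUl _ _) ady dety iK pos (pinned_sub dety)).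
by move=> j; rewrite setDv inE.
Qed.

(** Rows that meet [K] without being contained in it are added one at a time; the complement of [K]
    shrinks at each step. *)
Lemma region_closure i0 y K : region i0 y K ->
  exists2 z, region i0 z (cl K) & same_signs y z K.
Proof.
move: {2}#|_|.+1 (ltnSn #|~: K|) => k.
elim: k K y => // k IH K y lek gy.
have [cK|] := boolP (closed_cols K).
  have <- : K = cl K by apply/eqP; rewrite eqEsubset sub_cl cl_min.
  by exists y.
rewrite negb_forall => /existsP[i ]; rewrite negb_imply => /andP[iK NK].
have [z gz sz] := region_step gy iK.
have [|w gw sw] := IH _ _ _ gz.
  rewrite -ltnS; apply: leq_trans lek; rewrite ltnS; apply: proper_card.
  by rewrite properE !setCS subsetUl subUset subxx.
exists w; first by rewrite -(cl_step iK).
apply: same_signs_trans sz _; exact: same_signs_sub (subsetUl _ _) sw.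
Qed.

Lemma span_good i0 K : N i0 != set0 -> span i0 K -> exists y, region i0 y K.
Proof.
move=> N0; elim=> [|{}K i _ [y gy] iK]; last first.
  by have [z gz _] := region_step gy iK; exists z.
exists (fun j => (j \in N i0)%:R); split=> [|| j ->]; first split=> [j|i iK].
- by rewrite pnatr_eq0 eqb0 negbK.
- rewrite /ell (big_setID (N i0)) /= [X in _ + X]big1 ?addr0; last first.
    by move=> j /setDP[_ /negPf->].
  rewrite (eq_bigr (fun=> 1)); last by move=> j /setIP[_ ->].
  by rewrite sumr_const pnatr_eq0 cards_eq0.
- exact: pinned_row.
- exact: ltr01.
Qed.

(** Moving a coordinate [b] of [K] that lies in exactly one of the two rows changes one form and not
    the other. A small move stays in the region, since every coordinate and form on [K] is already
    nonzero. *)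
Lemma region_separate i0 i1 i2 y K : region i0 y K ->
  N i1 :&: K != N i2 :&: K -> exists2 z, region i0 z K & ell z i1 != ell z i2.
Proof.
move=> [ady dety pos] neN.
have [eq12|ne12] := eqVneq (ell y i1) (ell y i2); last by exists y.
have [b bK bN] : exists2 b, b \in K & (b \in N i1) != (b \in N i2).
  apply/exists_inP; apply: contraNT neN; rewrite negb_exists_in => /forall_inP eqN.
  apply/eqP/setP=> b; rewrite !inE; case bK: (b \in K); rewrite ?andbF // !andbT.
  by apply/eqP; rewrite -[_ == _]negbK eqN.
pose w j : R := (j == b)%:R.
have ellw i : ell w i = (b \in N i)%:R.
  have [bi|bi] := boolP (b \in N i).
    rewrite /ell (bigD1 b) //= /w eqxx big1 ?addr0 // => j /andP[_ /negPf->] //.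
  by rewrite ell0 // => j ji; rewrite /w; case: eqP => // jb; rewrite -jb ji in bi.
pose al (f : 'I_n + I) := match f with inl j => y j | inr i => ell y i end.
pose be (f : 'I_n + I) := match f with inl j => w j | inr i => ell w i end.
have [t t0 sgt] := small_perturb al be.
pose z j := y j + t * w j.
have sgs : same_signs y z K.
  split=> [j jK|i iK].
    by have := sgt (inl j); rewrite /= -ady.1 /= in jK *; rewrite (negPf jK).
  by have := sgt (inr i); rewrite /= -ellD (negPf (ady.2 _ iK)).
exists z; last first.
  rewrite !ellD eq12 !ellw; apply: contra_neq bN => /addrI /(mulfI (lt0r_neq0 t0)) /eqP.
  by rewrite eqr_nat; case: (b \in N i1); case: (b \in N i2).
split.
- apply: (generic_same_signs ady _ sgs) => j jK; rewrite /z (generic0 ady jK) /w.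
  by case: eqP jK => [->|_ _]; rewrite ?bK // mulr0 addr0.
- exact: pinned_same_signs dety sgs.
- by move=> j jN; rewrite -sgr_gt0 sgs.1 ?sgr_gt0 ?pos //; apply: (subsetP (pinned_sub dety)).
Qed.

(* The coordinate y_a = v is finite; the other new coordinates of row i are
   infinitesimal with the sign of v, so that row i pins all of them. *)
Lemma region_new i0 i i2 a y K v : region i0 y K ->
  meets K i -> meets K i2 -> a \in N i -> a \in N i2 -> a \notin K ->
  v != 0 -> (forall i', a \in N i' -> ell y i' + v != 0) ->
  v * (ell y i + v) < 0 ->
  exists z, [/\ region i0 z (cl K), Num.sg (z a * ell z i) = -1 &
    Num.sg (z a * ell z i2) = Num.sg (v * (ell y i2 + v))].
Proof.
move=> [ady dety pos] iK i2K ai ai2 aK v0 gen neg.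
pose w j : R := (j == a)%:R.
have ellw i' : ell w i' = (a \in N i')%:R.
  have [ai'|ai'] := boolP (a \in N i').
    by rewrite /ell (bigD1 a) //= /w eqxx big1 ?addr0 // => j /andP[_ /negPf->].
  by rewrite ell0 // => j ji; rewrite /w; case: eqP => // ja; rewrite -ja ji in ai'.
pose y1 j := y j + v * w j.
have ya : y a = 0 by rewrite (generic0 ady).
have y1a : y1 a = v by rewrite /y1 ya /w eqxx mulr1 add0r.
have y1K j : j != a -> y1 j = y j by move=> /negPf ja; rewrite /y1 /w ja mulr0 addr0.
have ell1 i' : a \in N i' -> ell y1 i' = ell y i' + v.
  by move=> ai'; rewrite ellD ellw ai' mulr1.
have ell1K i' : a \notin N i' -> ell y1 i' = ell y i'.
  by move=> /negPf ai'; rewrite ellD ellw ai' mulr0 addr0.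
have neK j : j \in K -> j != a by apply: contraTneq => ->.
have ad1 : generic y1 (a |: K).
  have [a1 a2] := ady; split=> [j|i' i'K].
    rewrite in_setU1; case: (eqVneq j a) => [->|ja]; first by rewrite y1a v0.
    by rewrite y1K // a1.
  have [ai'|ai'] := boolP (a \in N i'); first by rewrite ell1 ?gen.
  rewrite ell1K // a2 //; move: i'K => /set0Pn[j]; rewrite !inE => /andP[].
  move=> jN /orP[/eqP ja|jK]; first by rewrite -ja jN in ai'.
  by apply/set0Pn; exists j; rewrite inE jN.
have det1 : pinned i0 y1 K.
  apply: pinned_sg dety _ _ => [j /neK/y1K->//|k kK]; rewrite ell1K //.
  by apply: contraNN aK; apply: (subsetP kK).
have N0K := pinned_sub dety.
have sK1 : K \subset a |: K by exact: subsetUr.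
have [|||z gz sz] := region_extend sK1 _ ad1 det1 iK _ N0K.
- by rewrite subUset subsetUl andbT sub1set inE ai orbT.
- by move=> j jN; rewrite y1K ?pos // neK // (subsetP N0K).
- move=> j; rewrite !inE => /andP[/negPf->]; rewrite orbF => /eqP->.
  by rewrite y1a ell1.
have [w' gw sw] := region_closure gz.
have sgw i' : meets K i' -> a \in N i' ->
    Num.sg (w' a * ell w' i') = Num.sg (v * (ell y i' + v)).
  move=> i'K ai'; rewrite sgrM sw.1 ?sw.2 ?inE ?ai ?orbT //; last first.
    exact: meetsS (subsetUl _ _) i'K.
  by rewrite sz.1 ?sz.2 ?setU11 ?(meetsS sK1) // y1a ell1 // -sgrM.
exists w'; rewrite !sgw // ltr0_sg //; split=> //.
by rewrite -(cl_step iK).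
Qed.

(* One point in each bounded interval of the complement of {0, -A, -B}. *)
Lemma two_signs (A B : R) (bad : seq R) : A != 0 -> B != 0 -> A != B ->
  exists v1 v2, [/\ v1 != 0, v2 != 0, v1 \notin bad, v2 \notin bad &
    [\/ [/\ v1 * (A + v1) < 0, v2 * (A + v2) < 0,
            v1 * (B + v1) < 0 & 0 < v2 * (B + v2)],
        [/\ v1 * (B + v1) < 0, v2 * (B + v2) < 0,
            v1 * (A + v1) < 0 & 0 < v2 * (A + v2)] |
        [/\ v1 * (A + v1) < 0, v2 * (B + v2) < 0,
            0 < v1 * (B + v1) & 0 < v2 * (A + v2)]]].
Proof.
move=> A0 B0 neAB.
have pick (p q : R) : p < q -> exists v, [/\ p < v, v < q & v \notin bad].
  exact: itv_avoid.
have nz (v p q : R) : p < v -> v < q -> 0 <= p \/ q <= 0 -> v != 0.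
  by move=> pv vq [p0|q0]; [rewrite gt_eqF //|rewrite lt_eqF //]; lra.
(* The condition [v * (A + v) < 0] places [v] strictly between 0 and [- A], so that the row with
   value [A] pins. According to the order of 0, [- A] and [- B], the same row pins at both points,
   or each row pins at one of them. *)
have [A_lt|A_gt|/eqP] := ltgtP A 0; last by rewrite (negPf A0).
  have [B_lt|B_gt|/eqP] := ltgtP B 0; last by rewrite (negPf B0).
    have [AB|BA|/eqP] := ltgtP A B; last by rewrite (negPf neAB).
      have [|v1 [l1 u1 b1]] := pick 0 (- B); first lra.
      have [|v2 [l2 u2 b2]] := pick (- B) (- A); first lra.
      exists v1, v2; split=> //; try (apply: nz l1 u1 _ || apply: nz l2 u2 _; lra).
      by apply: Or31; split; nra.
    have [|v1 [l1 u1 b1]] := pick 0 (- A); first lra.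
    have [|v2 [l2 u2 b2]] := pick (- A) (- B); first lra.
    exists v1, v2; split=> //; try (apply: nz l1 u1 _ || apply: nz l2 u2 _; lra).
    by apply: Or32; split; nra.
  have [|v1 [l1 u1 b1]] := pick 0 (- A); first lra.
  have [|v2 [l2 u2 b2]] := pick (- B) 0; first lra.
  exists v1, v2; split=> //; try (apply: nz l1 u1 _ || apply: nz l2 u2 _; lra).
  by apply: Or33; split; nra.
have [B_lt|B_gt|/eqP] := ltgtP B 0; last by rewrite (negPf B0).
  have [|v1 [l1 u1 b1]] := pick (- A) 0; first lra.
  have [|v2 [l2 u2 b2]] := pick 0 (- B); first lra.
  exists v1, v2; split=> //; try (apply: nz l1 u1 _ || apply: nz l2 u2 _; lra).
  by apply: Or33; split; nra.
have [AB|BA|/eqP] := ltgtP A B; last by rewrite (negPf neAB).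
  have [|v1 [l1 u1 b1]] := pick (- A) 0; first lra.
  have [|v2 [l2 u2 b2]] := pick (- B) (- A); first lra.
  exists v1, v2; split=> //; try (apply: nz l1 u1 _ || apply: nz l2 u2 _; lra).
  by apply: Or32; split; nra.
have [|v1 [l1 u1 b1]] := pick (- B) 0; first lra.
have [|v2 [l2 u2 b2]] := pick (- A) (- B); first lra.
exists v1, v2; split=> //; try (apply: nz l1 u1 _ || apply: nz l2 u2 _; lra).
by apply: Or31; split; nra.
Qed.

(** One value of [y a] in each bounded interval is extended to the whole component. The sign of
    [y a * ell y i] is compared because it is the sign of the cell [(i, a)] of the resulting
    critical point, up to factors common to all regions. *)
Lemma two_regions i0 i1 i2 a K : N i0 != set0 -> span i0 K ->
  a \in N i1 -> a \in N i2 -> a \notin K -> meets K i1 -> meets K i2 ->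
  N i1 :&: K != N i2 :&: K ->
  exists y z i, [/\ region i0 y (cl (N i0)), region i0 z (cl (N i0)), a \in N i,
    meets (cl (N i0)) i & Num.sg (y a * ell y i) != Num.sg (z a * ell z i)].
Proof.
move=> N0 sK a1 a2 aK m1 m2 ne12; rewrite -(cl_span sK).
have [y0 gy0] := span_good N0 sK.
have [y gy ney] := region_separate gy0 ne12.
have [ady _ _] := gy; have [_ ell_neq0] := ady.
(* The avoided values are those at which some row form through [a] would vanish. *)
have [v1 [v2 [v10 v20 bad1 bad2 cases]]] :=
  two_signs [seq - ell y i | i <- enum I] (ell_neq0 _ m1) (ell_neq0 _ m2) ney.
have gen v : v \notin [seq - ell y i | i <- enum I] ->
    forall i', a \in N i' -> ell y i' + v != 0.
  move=> bad i' _; apply: contraNneq bad => /eqP; rewrite addrC addr_eq0 => /eqP->.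
  by apply: map_f; rewrite mem_enum.
have mcl i : meets K i -> meets (cl K) i by apply: meetsS; exact: sub_cl.
have ne1 : (-1 : R) != 1 by rewrite lt_eqF //; lra.
case: cases => -[n1 n2 s1 s2].
- have [w1 [g1 _ t1]] := region_new gy m1 m2 a1 a2 aK v10 (gen _ bad1) n1.
  have [w2 [g2 _ t2]] := region_new gy m1 m2 a1 a2 aK v20 (gen _ bad2) n2.
  by exists w1, w2, i2; rewrite t1 t2 (ltr0_sg s1) (gtr0_sg s2) mcl.
- have [w1 [g1 _ t1]] := region_new gy m2 m1 a2 a1 aK v10 (gen _ bad1) n1.
  have [w2 [g2 _ t2]] := region_new gy m2 m1 a2 a1 aK v20 (gen _ bad2) n2.
  by exists w1, w2, i1; rewrite t1 t2 (ltr0_sg s1) (gtr0_sg s2) mcl.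
- have [w1 [g1 t1 _]] := region_new gy m1 m2 a1 a2 aK v10 (gen _ bad1) n1.
  have [w2 [g2 _ t2]] := region_new gy m2 m1 a2 a1 aK v20 (gen _ bad2) n2.
  by exists w1, w2, i1; rewrite t1 t2 (gtr0_sg s2) mcl.
Qed.

End Arrangement.

(** * Boundedness of regions and their critical points *)

Section CriticalSolution.
Variables (R : realType) (I : finType) (n : nat) (N : I -> {set 'I_n}).
Implicit Types (K D : {set 'I_n}) (y z : 'I_n -> R) (i : I) (j : 'I_n).

Local Notation ell := (@ell R I n N).

(** On the root row the coordinates are nonnegative with sum 1. When row [i] is added, its new
    coordinates all have the sign opposite to its form, so the sum of their absolute values is at
    most that of its old coordinates, which are bounded by induction. *)
Lemma pinned_bounded i0 y K : pinned N i0 y K -> (forall j, j \in N i0 -> 0 < y j) ->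
  exists2 B, 0 <= B & forall z, (forall j, j \in K -> 0 <= y j * z j) ->
    (forall i, N i \subset K -> 0 <= ell y i * ell z i) -> ell z i0 = 1 ->
    forall j, j \in K -> `|z j| <= B.
Proof.
move=> dety pos; elim: dety => [|{}K i _ [B B0 bound] neg].
  exists 1 => // z zpos _ z1 j jN.
  have zge k : k \in N i0 -> 0 <= z k.
    by move=> kN; have := zpos k kN; rewrite pmulr_rge0 ?pos.
  rewrite ger0_norm ?zge // -z1 /ell (bigD1 j) //= lerDl.
  by apply: sumr_ge0 => k /andP[/zge].
exists (B + #|N i :&: K|%:R * B) => [|z zpos zell z1 j].
  by rewrite addr_ge0 // mulr_ge0.
have {}bound k : k \in K -> `|z k| <= B.
  apply: bound => // [k' kK|i' iK]; first by rewrite zpos // inE kK.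
  by rewrite zell // (subset_trans iK) ?subsetUl.
have B1 : 0 <= #|N i :&: K|%:R * B by rewrite mulr_ge0.
have [jK _|jK] := boolP (j \in K); first by apply: le_trans (bound j jK) _; rewrite lerDl.
rewrite inE (negPf jK) /= => jN.
set s := Num.sg (ell y i).
have znew k : k \in N i :\: K -> `|z k| = - (s * z k).
  move=> kN; have := neg k kN; have : 0 <= y k * z k.
    by apply: zpos; move: kN; rewrite !inE => /andP[_ ->]; rewrite orbT.
  rewrite /s; case: sgrP => [->|e0|e0] yz ye.
  - by rewrite mulr0 ltxx in ye.
  - have y0 : y k < 0 by rewrite -(pmulr_llt0 _ e0).
    by rewrite mul1r ler0_norm // -(nmulr_rge0 _ y0).
  - have y0 : 0 < y k by rewrite -(nmulr_llt0 _ e0).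
    by rewrite mulN1r opprK ger0_norm // -(pmulr_rge0 _ y0).
have sell : 0 <= s * ell z i.
  have := zell i (subsetUr _ _); rewrite /s; case: sgrP => [->|e0|e0].
  - by rewrite mul0r.
  - by rewrite mul1r pmulr_rge0.
  - by rewrite mulN1r nmulr_rge0 // oppr_ge0.
have jNK : j \in N i :\: K by rewrite inE jK.
have : `|z j| <= \sum_(k in N i :\: K) `|z k|.
  by rewrite (bigD1 j) //= lerDl sumr_ge0.
move/le_trans; apply; rewrite (eq_bigr _ znew) sumrN -mulr_sumr.
move: sell; rewrite /ell (big_setID K) /= mulrDr => sell.
have : s * (\sum_(k in N i :&: K) z k) <= #|N i :&: K|%:R * B.
  apply: le_trans (ler_norm _) _; rewrite normrM.
  have s1 : `|s| <= 1 by rewrite normr_sg lern1 leq_b1.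
  apply: le_trans (ler_wpM2r (normr_ge0 _) s1) _; rewrite mul1r.
  apply: le_trans (ler_norm_sum _ _ _) _.
  rewrite mulr_natl -sumr_const; apply: ler_sum => k /setIP[_]; exact: bound.
lra.
Qed.

(* The root exponent is determined by the others, as the product has degree 0. *)
Lemma critical_solution i0 y D (c : 'I_n -> nat) (e : I -> nat) :
  N i0 != set0 -> region N i0 y D -> closed_cols N D ->
  (forall j, j \in D -> (0 < c j)%N) ->
  (forall i, meets N D i -> i != i0 -> (0 < e i)%N) ->
  let r i : R := if i == i0
    then (\sum_(j in D) c j + \sum_(i | meets N D i && (i != i0)) e i)%:R
    else - (e i)%:R in
  exists z, [/\ forall j, j \in D -> 0 < y j * z j,
    forall i, meets N D i -> 0 < ell y i * ell z i,
    ell z i0 = 1 &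
    forall j, j \in D ->
      \sum_(i | j \in N i) r i / ell z i * z j = (c j)%:R].
Proof.
move=> N0 gy cD c0 e0 r; have [ady dety pos] := gy; have [ady1 ady2] := ady.
have N0D := pinned_sub dety.
have NiD i : meets N D i -> N i \subset D by move/forallP/(_ i)/implyP: cD.
have y0pos : 0 <= ell y i0 by apply: sumr_ge0 => j /pos/ltW.
have ey0 : 0 < ell y i0.
  rewrite lt0r y0pos andbT ady2 //; case/set0Pn: N0 => j jN.
  by apply/set0Pn; exists j; rewrite inE jN (subsetP N0D).
(* Multiplying each form by its value at [y] makes it positive on the region of [y]. *)
pose a (f : 'I_n + I) (k : 'I_n) : R := match f with
  | inl j => y j * (k == j)%:R | inr i => ell y i * (k \in N i)%:R end.
pose P (f : 'I_n + I) := match f with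
  | inl j => j \in D | inr i => meets N D i && (i != i0) end.
pose ce (f : 'I_n + I) := match f with inl j => c j | inr i => e i end.
(* [None] is the chart equation; [Some j] fixes a coordinate outside [D], and is the zero form for
   [j] in [D]. *)
pose cc (f : option 'I_n) (k : 'I_n) : R := match f with
  | None => (k \in N i0)%:R | Some j => ((k == j) && (j \notin D))%:R end.
have lin_mem (A : {set 'I_n}) z : lin (fun k => (k \in A)%:R) z = \sum_(j in A) z j.
  rewrite /lin [RHS]big_mkcond; apply: eq_bigr => k _.
  by case: (k \in A); rewrite ?mul1r ?mul0r.
have lin_al z j : lin (a (inl j)) z = y j * z j.
  rewrite /lin (bigD1 j) //= eqxx mulr1 big1 ?addr0 // => k /negPf->.
  by rewrite mulr0 mul0r.
have lin_ar z i : lin (a (inr i)) z = ell y i * ell z i.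
  rewrite /ell -[X in _ * X]lin_mem /lin mulr_sumr; apply: eq_bigr => k _.
  by rewrite mulrA.
have lin_cn z : lin (cc None) z = ell z i0 by exact: lin_mem.
have lin_cs z j : lin (cc (Some j)) z = if j \in D then 0 else z j.
  rewrite /lin (bigD1 j) //= eqxx /= big1 ?addr0.
    by case: (j \in D); rewrite ?mul1r ?mul0r.
  by move=> k /negPf->; rewrite mul0r.
pose y0 j := y j / ell y i0.
have ell_y0 i : ell y0 i = ell y i / ell y i0 by rewrite /ell mulr_suml.
have y0_out j : j \notin D -> y0 j = 0 by move=> jD; rewrite /y0 (generic0 ady jD) mul0r.
have [B B0 bound] := pinned_bounded dety pos.
have [|||z [zc zpos zcrit]] := @positive_critical_point R n _ P a ce _ cc y0 B.
- case=> [j jD|i /andP[iD _]]; rewrite ?lin_al ?lin_ar.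
    by rewrite /y0 mulrA mulr_gt0 ?invr_gt0 // -expr2 exprn_even_gt0 //= ady1.
  by rewrite ell_y0 mulrA mulr_gt0 ?invr_gt0 // -expr2 exprn_even_gt0 //= ady2.
- by case=> [j|i] /=; [exact: c0|move=> /andP[/e0]].
- move=> z zc zpos j; have [jD|jD] := boolP (j \in D); last first.
    have := zc (Some j); rewrite !lin_cs (negPf jD) y0_out // => ->.
    by rewrite normr0.
  have z1 : ell z i0 = 1 by have := zc None; rewrite !lin_cn ell_y0 divff // gt_eqF.
  apply: bound => // [k kD|i iD]; first by have := zpos (inl k) kD; rewrite lin_al.
  have [iD'|] := boolP (meets N D i); last first.
    rewrite negbK (setIidPl iD) => /eqP Ni.
    by rewrite [ell y i]ell0 ?mul0r // => k; rewrite Ni inE.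
  have [->|ii0] := eqVneq i i0; first by rewrite z1 mulr1 ltW.
  by have := zpos (inr i); rewrite /= iD' ii0 lin_ar; apply.
have z1 : ell z i0 = 1 by have := zc None; rewrite !lin_cn ell_y0 divff // gt_eqF.
have zD j : j \in D -> 0 < y j * z j by move=> jD; have := zpos (inl j) jD; rewrite lin_al.
have zI i : meets N D i -> 0 < ell y i * ell z i.
  move=> iD; have [->|ii0] := eqVneq i i0; first by rewrite z1 mulr1.
  by have := zpos (inr i); rewrite /= iD ii0 lin_ar; apply.
exists z; split=> // j jD.
pose b : R := (j \in N i0)%:R.
(* The basis vector of [j], corrected along [z] to be tangent to the chart. By Euler's relation the
   correction contributes the degree of the maximized product, which is the exponent of the root
   row. *)
pose d k := (k == j)%:R - b * z k.
have ell_d i : ell d i = (j \in N i)%:R - b * ell z i.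
  rewrite /ell /d sumrB -mulr_sumr; congr (_ - _).
  have [jN|jN] := boolP (j \in N i).
    by rewrite (bigD1 j) //= eqxx big1 ?addr0 // => k /andP[_ /negPf->].
  by rewrite big1 // => k kN; case: eqP jN => // <-; rewrite kN.
have zj0 : z j != 0 by move: (zD j jD); apply: contraTneq => ->; rewrite mulr0 ltxx.
have /zcrit : forall k, lin (cc k) d = 0.
  case=> [k|]; last by rewrite lin_cn ell_d z1 mulr1 subrr.
  rewrite lin_cs; case: ifP => // kD; rewrite /d.
  have := zc (Some k); rewrite !lin_cs kD y0_out ?kD // => ->.
  by rewrite mulr0 subr0; case: eqP kD => // ->; rewrite jD.
rewrite big_sumType /=.
have -> : \sum_(k in D) (c k)%:R * lin (a (inl k)) d / lin (a (inl k)) z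
    = (c j)%:R / z j - b * (\sum_(k in D) c k)%:R.
  rewrite natr_sum mulr_sumr (bigD1 j) //= [X in _ = _ - X](bigD1 j) //=.
  rewrite !lin_al opprD addrA -sumrN; congr (_ + _).
    rewrite /d eqxx /=; field; rewrite zj0 ady1 jD //.
  apply: eq_bigr => k /andP[kD kj]; rewrite !lin_al /d (negPf kj) /=.
  have zk0 : z k != 0 by move: (zD k kD); apply: contraTneq => ->; rewrite mulr0 ltxx.
  field; rewrite zk0 ady1 kD //.
pose Q i := meets N D i && (i != i0).
have ez i : meets N D i -> ell z i != 0.
  by move=> /zI; apply: contraTneq => ->; rewrite mulr0 ltxx.
have -> : \sum_(i | Q i) (e i)%:R * lin (a (inr i)) d / lin (a (inr i)) z
    = \sum_(i | Q i) (e i)%:R * (j \in N i)%:R / ell z i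
      - b * (\sum_(i | Q i) e i)%:R.
  rewrite natr_sum mulr_sumr -sumrB; apply: eq_bigr => i /andP[iD _].
  by rewrite !lin_ar ell_d; field; rewrite ez ?ady2.
have rE : \sum_(i | j \in N i) r i / ell z i =
    b * (\sum_(j in D) c j + \sum_(i | Q i) e i)%:R
    - \sum_(i | Q i) (e i)%:R * (j \in N i)%:R / ell z i.
  rewrite big_mkcond (bigD1 i0) //= {1}/r eqxx z1 divr1; congr (_ + _).
    by rewrite /b; case: (j \in N i0); rewrite ?mul1r ?mul0r.
  rewrite -sumrN big_mkcond [RHS]big_mkcond; apply: eq_bigr => i _.
  rewrite /Q; case: (eqVneq i i0) => [|ii0]; rewrite ?andbF // andbT.
  have [jN|jN] := boolP (j \in N i); last by rewrite mulr0 mul0r oppr0 if_same.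
  have -> : meets N D i by apply/set0Pn; exists j; rewrite inE jN.
  by rewrite /r (negPf ii0) mulr1 mulNr.
rewrite -mulr_suml rE natrD => crit.
have -> : (c j)%:R = (c j)%:R / z j * z j by rewrite divfK.
congr (_ * _); lra.
Qed.

End CriticalSolution.
(** * Uniqueness of the critical point for generic data *)

Section MaximumLikelihood.
Variables (C : fieldType) (d N : nat) (A : 'M[int]_(d, N)).

Lemma critical_point_vanishing (u p : 'cV[C]_N) f :
  critical_point A u p -> likelihood_ideal A u f -> eval f p = 0.
Proof.
case=> p0 p1 ptoric pcrit [l [lG ->]].
rewrite /eval raddf_sum big1_seq // => q /andP[_ /lG G].
rewrite /= mevalM; suff -> : (q.2).@[fun s => p s 0] = 0 by rewrite mulr0.
case: G => [/ptoric//|->|[k ->]].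
  rewrite mevalB meval1 raddf_sum /= -[X in _ - X]p1 /Defs.total.
  by rewrite (eq_bigr (fun s => p s 0)) ?subrr // => s _; rewrite mevalXU.
rewrite raddf_sum /=.
under eq_bigr do rewrite mevalM rmorph_int mevalB mevalZ mevalXU mevalC mulrBr.
rewrite sumrB; apply/eqP; rewrite subr_eq0 eq_sym; apply/eqP.
have /matrixP/(_ k 0) := pcrit; rewrite !mxE.
rewrite (eq_bigr (fun s => (A k s)%:~R * u s 0)) => [->|s _]; last by rewrite mxE.
rewrite mulr_sumr; apply: eq_bigr => s _.
by rewrite mxE mulrCA.
Qed.

(** Every critical point has positive multiplicity: multiplicity 0 would put 1 in the localized
    ideal, and so give an element of the likelihood ideal that is nonzero at the point. A total of 1
    then leaves exactly one point. *)
Lemma ml_degree1_unique : ml_degree C A 1 ->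
  exists2 g : {mpoly C[N]}, g != 0 & forall u, eval g u != 0 ->
    exists2 p, critical_point A u p & forall q, critical_point A u q -> q = p.
Proof.
case=> g [g0 gml]; exists g => // u /gml[ps [mu [ups psP multP sum1]]].
have mu_gt0 p : p \in ps -> (0 < mu p)%N.
  move=> pps; have pcrit := (psP p).1 pps.
  rewrite lt0n; apply/eqP => mu0; have := multP p pps; rewrite mu0.
  case=> b [span _]; have [a] := span 1; rewrite big_ord0 subr0.
  case=> h [hp]; rewrite mulr1 => /(critical_point_vanishing pcrit) h0.
  by rewrite h0 eqxx in hp.
case: ps ups psP multP sum1 mu_gt0 => [|p [|q ps]].
- by move=> _ _ _; rewrite big_nil.
- move=> _ psP _ _ _; exists p; first by apply/psP; rewrite inE.
  by move=> q /psP; rewrite inE => /eqP.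
- move=> _ _ _ + mu_gt0; rewrite !big_cons => sum1.
  have := mu_gt0 p; have := mu_gt0 q; rewrite !inE !eqxx orbT /= => /(_ isT) + /(_ isT).
  by move: sum1; lia.
Qed.

End MaximumLikelihood.

(** * Integer points off a hypersurface *)

Section GenericPoints.
Variable C : numFieldType.

Lemma poly_nat_neq0 (q : {poly C}) (M : nat) :
  q != 0 -> exists2 k, (M <= k)%N & q.[k%:R] != 0.
Proof.
move=> q0.
pose rs : seq C := [seq k%:R | k <- iota M (size q)].
have [/allP rsP|/allPn[x /mapP[k]]] := boolP (all (root q) rs); last first.
  by rewrite mem_iota => /andP[Mk _] ->; exists k.
have := max_poly_roots q0 (introT allP rsP).
rewrite map_inj_uniq ?iota_uniq => [|k l /eqP]; last by rewrite eqr_nat => /eqP.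
by rewrite size_map size_iota ltnn => /(_ isT).
Qed.

Lemma horner_mmap N (h : 'I_N -> {poly C}) (g : {mpoly C[N]}) t :
  (mmap polyC h g).[t] = g.@[fun s => (h s).[t]].
Proof.
rewrite mevalE /mmap horner_sum; apply: eq_bigr => m _.
rewrite hornerM hornerC horner_prod; congr (_ * _).
by apply: eq_bigr => s _; rewrite horner_exp.
Qed.

(** Uniqueness of base [B] expansions, which makes the Kronecker substitution injective on monomials
    with exponents below [B]. *)
Lemma digits_inj N B (a b : 'I_N -> nat) : (forall s, (a s < B)%N) ->
  (forall s, (b s < B)%N) ->
  (\sum_(s < N) a s * B ^ s = \sum_(s < N) b s * B ^ s)%N -> a =1 b.
Proof.
elim: N a b => [|N IH] a b aB bB; first by move=> _ [].
rewrite !big_ord_recl !expn0 !muln1.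
have shift (c : 'I_N.+1 -> nat) : (\sum_(s < N) c (lift ord0 s) * B ^ lift ord0 s =
    (\sum_(s < N) c (lift ord0 s) * B ^ s) * B)%N.
  rewrite big_distrl /=; apply: eq_bigr => s _.
  by rewrite /bump leq0n expnS mulnCA mulnC.
rewrite !shift => eqab.
have B0 : (0 < B)%N by apply: leq_ltn_trans (aB ord0).
have eq0 : a ord0 = b ord0.
  by have := congr1 (modn^~ B) eqab; rewrite /= ![(_ ord0 + _)%N]addnC !modnMDl !modn_small.
move: eqab; rewrite eq0 => /addnI/eqP; rewrite eqn_pmul2r // => /eqP eqs s.
have := IH (fun s => a (lift ord0 s)) (fun s => b (lift ord0 s)) _ _ eqs.
case: (unliftP ord0 s) => [k ->|->] // H; exact: H.
Qed.

(* Kronecker substitution X_s := X ^ (B ^ s). *)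
Lemma mpoly_nat_neq0 N (g : {mpoly C[N]}) :
  g != 0 -> exists v : 'I_N -> nat, g.@[fun s => (v s)%:R] != 0.
Proof.
move=> g0; pose B := msize g.
pose q := mmap polyC (fun s : 'I_N => 'X^(B ^ s)) g.
have mB m : m \in msupp g -> forall s, (m s < B)%N.
  move=> mg s; apply: leq_ltn_trans (msize_mdeg_lt mg).
  by rewrite mdegE (bigD1 s) //= leq_addr.
have code (m : 'X_{1..N}) : mmap1 (fun s : 'I_N => 'X^(B ^ s)) m
    = 'X^(\sum_(s < N) m s * B ^ s) :> {poly C}.
  rewrite /mmap1; under eq_bigr do rewrite -exprM mulnC.
  by rewrite -expr_sum.
have [k _ qk] : exists2 k, (0 <= k)%N & q.[k%:R] != 0.
  apply: poly_nat_neq0; apply: contra_neq g0 => q0.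
  apply/mpolyP => m; rewrite mcoeff0; apply/eqP; rewrite mcoeff_eq0.
  apply/negP => mg.
  have : q`_(\sum_(s < N) m s * B ^ s) = 0 by rewrite q0 coef0.
  rewrite /q /mmap coef_sum (bigD1_seq m) ?msupp_uniq //= coefCM code coefXn eqxx mulr1.
  rewrite big1_seq ?addr0 => [gm|m' /andP[m'm m'g]].
    by move: mg; rewrite mcoeff_msupp gm eqxx.
  rewrite coefCM code coefXn; case: eqP => [e|_]; last by rewrite mulr0.
  case/eqP: m'm; apply/mnmP => s; symmetry.
  by apply: (digits_inj (mB _ mg) (mB _ m'g)).
exists (fun s => (k ^ (B ^ s))%N).
move: qk; rewrite horner_mmap; congr (_ != _); apply: meval_eq => s.
by rewrite hornerXn natrX.
Qed.

(** On the line through [v] with direction [f], the polynomial [g] becomes univariate and is nonzero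
    at parameter 0. Generic data can thus be pushed arbitrarily far in any integer direction. *)
Lemma mpoly_line_neq0 N (g : {mpoly C[N]}) (f : 'I_N -> int) : g != 0 ->
  exists (v : 'I_N -> nat), forall M, exists2 k, (M <= k)%N &
    g.@[fun s => ((v s)%:Z + k%:Z * f s)%:~R] != 0.
Proof.
move=> /mpoly_nat_neq0[v gv]; exists v => M0.
pose q := mmap polyC (fun s => (v s)%:R%:P + (f s)%:~R *: 'X) g.
have [|k Mk qk] := @poly_nat_neq0 q M0.
  apply: contraNneq gv => q0.
  have := horner_mmap (fun s => (v s)%:R%:P + (f s)%:~R *: 'X) g 0.
  rewrite -/q q0 horner0 => gz; rewrite {1}gz; apply/eqP.
  by apply: meval_eq => s; rewrite !hornerE.
exists k => //; move: qk; rewrite horner_mmap; congr (_ != _).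
by apply: meval_eq => s; rewrite !hornerE rmorphD rmorphM /= mulrC.
Qed.

End GenericPoints.
Lemma sum_Posz_eq (I : finType) (P : pred I) (a b : I -> nat) :
  \sum_(s | P s) ((a s)%:Z - (b s)%:Z) = 0 ->
  (\sum_(s | P s) a s = \sum_(s | P s) b s)%N.
Proof.
have sumE (c : I -> nat) : \sum_(s | P s) (c s)%:Z = (\sum_(s | P s) c s)%N%:Z.
  by rewrite -[RHS]intz sumMz; apply: eq_bigr => s _; rewrite intz.
by rewrite sumrB !sumE => /eqP; rewrite subr_eq0 => /eqP[].
Qed.

(** * Margins of tables supported on [S], and replacement of a critical point on one component *)

Section Margins.
Variables (m n : nat) (S : {set 'I_m * 'I_n}).

Definition row_cols (i : 'I_m) : {set 'I_n} := [set j | (i, j) \in S].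

Definition rsum (V : nmodType) (w : 'I_#|S| -> V) (i : 'I_m) : V :=
  \sum_(s | (enum_val s).1 == i) w s.

Definition csum (V : nmodType) (w : 'I_#|S| -> V) (j : 'I_n) : V :=
  \sum_(s | (enum_val s).2 == j) w s.

Lemma rsum_cells (V : nmodType) (F : 'I_m * 'I_n -> V) i :
  rsum (fun s => F (enum_val s)) i = \sum_(j in row_cols i) F (i, j).
Proof.
rewrite /rsum -(big_enum_val_cond (A := mem S) (fun c => c.1 == i) F).
rewrite (reindex_onto (fun j => (i, j)) snd) /=; last by case=> a b /= /andP[_ /eqP->].
by apply: eq_bigl => j; rewrite !inE !eqxx !andbT.
Qed.

Lemma csum_cells (V : nmodType) (F : 'I_m * 'I_n -> V) j :
  csum (fun s => F (enum_val s)) j = \sum_(i | j \in row_cols i) F (i, j).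
Proof.
rewrite /csum -(big_enum_val_cond (A := mem S) (fun c => c.2 == j) F).
rewrite (reindex_onto (fun i => (i, j)) fst) /=; last by case=> a b /= /andP[_ /eqP->].
by apply: eq_bigl => i; rewrite !inE !eqxx !andbT.
Qed.

Lemma sum_csum (V : nmodType) (w : 'I_#|S| -> V) (D : {set 'I_n}) :
  \sum_(s | (enum_val s).2 \in D) w s = \sum_(j in D) csum w j.
Proof.
rewrite (partition_big (fun s : 'I_#|S| => (enum_val s).2) (mem D)) //=.
apply: eq_bigr => j jD; apply: eq_bigl => s.
by case: eqP => [->|]; rewrite ?andbF // andbT.
Qed.

Lemma qi_mulE (C : nzRingType) (w : 'I_#|S| -> C) k :
  \sum_s (quasi_independence_mx S k s)%:~R * w s =
  match split k with inl i => rsum w i | inr j => csum w j end.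
Proof.
rewrite /quasi_independence_mx /rsum /csum.
case: (split_ordP k) => [i ->|j ->].
  rewrite [RHS]big_mkcond; apply: eq_bigr => s _.
  by rewrite col_mxEu mxE; case: eqP; rewrite ?mul1r ?mul0r.
rewrite [RHS]big_mkcond; apply: eq_bigr => s _.
by rewrite col_mxEd mxE; case: eqP; rewrite ?mul1r ?mul0r.
Qed.

Lemma qi_kernelP (C : nzRingType) (w : 'I_#|S| -> C) :
  (forall k, \sum_s (quasi_independence_mx S k s)%:~R * w s = 0) <->
  (forall i, rsum w i = 0) /\ (forall j, csum w j = 0).
Proof.
split=> [H|[Hr Hc] k]; last by rewrite qi_mulE; case: (split k).
split=> [i |j].
  by have := H (lshift _ i); rewrite qi_mulE (unsplitK (inl i)).
by have := H (rshift _ j); rewrite qi_mulE (unsplitK (inr j)).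
Qed.

Lemma qi_critP (C : fieldType) (u p : 'cV[C]_#|S|) (T : C) :
  map_mx intr (quasi_independence_mx S) *m u =
    T *: (map_mx intr (quasi_independence_mx S) *m p) <->
  (forall i, rsum (u^~ 0) i = T * rsum (p^~ 0) i) /\
  (forall j, csum (u^~ 0) j = T * csum (p^~ 0) j).
Proof.
have mulE (w : 'cV[C]_#|S|) k : (map_mx intr (quasi_independence_mx S) *m w) k 0 =
    match split k with inl i => rsum (w^~ 0) i | inr j => csum (w^~ 0) j end.
  by rewrite mxE -qi_mulE; apply: eq_bigr => s _; rewrite mxE.
split=> [H|[Hr Hc]].
  split=> [i |j].
    have := congr1 (fun M : 'cV_(m + n) => M (lshift _ i) 0) H.
    by rewrite [in RHS]mxE !mulE (unsplitK (inl i)).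
  have := congr1 (fun M : 'cV_(m + n) => M (rshift _ j) 0) H.
  by rewrite [in RHS]mxE !mulE (unsplitK (inr j)).
apply/matrixP=> k l; rewrite (ord1 l) [in RHS]mxE !mulE.
by case: (split k).
Qed.

(* On the component with columns D the critical point p is replaced by x_i y_j;
   elsewhere it is kept, so that no existence statement is needed there. *)
Section Glue.
Variables (C : fieldType) (u p : 'cV[C]_#|S|) (D : {set 'I_n}).
Variables (x : 'I_m -> C) (y : 'I_n -> C).
Hypothesis pcrit : critical_point (quasi_independence_mx S) u p.
Hypothesis cD : closed_cols row_cols D.
Hypothesis x0 : forall i, meets row_cols D i -> x i != 0.
Hypothesis y0 : forall j, j \in D -> y j != 0.
Hypothesis rowE : forall i, meets row_cols D i ->
  rsum (u^~ 0) i = Defs.total u * \sum_(j in row_cols i) x i * y j.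
Hypothesis colE : forall j, j \in D ->
  csum (u^~ 0) j = Defs.total u * \sum_(i | j \in row_cols i) x i * y j.
Hypothesis T0 : Defs.total u != 0.

Definition glue_val s : C :=
  if (enum_val s).2 \in D then x (enum_val s).1 * y (enum_val s).2 else p s 0.

Definition glue : 'cV[C]_#|S| := \col_s glue_val s.

Lemma cell_meets (s : 'I_#|S|) : (enum_val s).2 \in D -> meets row_cols D (enum_val s).1.
Proof.
move=> sD; apply/set0Pn; exists (enum_val s).2; rewrite !inE sD andbT.
by rewrite -surjective_pairing enum_valP.
Qed.

Lemma cell_closed (s : 'I_#|S|) : meets row_cols D (enum_val s).1 -> (enum_val s).2 \in D.
Proof.
move/forallP/(_ (enum_val s).1)/implyP: cD => H /H/subsetP; apply.
by rewrite inE -surjective_pairing enum_valP.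
Qed.

Lemma cell_meetsE (s : 'I_#|S|) : meets row_cols D (enum_val s).1 = ((enum_val s).2 \in D).
Proof. by apply/idP/idP; [exact: cell_closed|exact: cell_meets]. Qed.

(** The two exponents of a generator have equal margins. On the component, a monomial evaluated at
    x_i y_j depends only on the margins of its exponent; elsewhere [p] satisfies the binomial whose
    exponents on the component are erased. *)
Lemma glue_toric f : toric_ideal C (quasi_independence_mx S) f -> eval f glue = 0.
Proof.
have [p0 p1 ptoric _] := pcrit.
case=> l [lG ->]; rewrite /eval raddf_sum big1_seq // => q /andP[_ /lG[a [b [kerab ->]]]].
rewrite /= mevalM; suff -> : ('X_[a] - 'X_[b]).@[fun s => glue s 0] = 0 by rewrite mulr0.
rewrite mevalB !mevalX; apply/eqP; rewrite subr_eq0; apply/eqP.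
have {}kerab : (forall i, rsum (fun s => (a s)%:Z - (b s)%:Z) i = 0) /\
    (forall j, csum (fun s => (a s)%:Z - (b s)%:Z) j = 0).
  by apply/qi_kernelP => k; rewrite -[RHS](kerab k); apply: eq_bigr => s _; rewrite intz.
have [kr kc] := kerab.
have glueE (e : 'X_{1..#|S|}) : \prod_s glue s 0 ^+ e s =
    (\prod_i x i ^+ (\sum_(s | ((enum_val s).2 \in D) && ((enum_val s).1 == i)) e s)
     * \prod_j y j ^+ (\sum_(s | ((enum_val s).2 \in D) && ((enum_val s).2 == j)) e s))
    * eval 'X_[[multinom (if (enum_val s).2 \in D then 0 else e s)%N | s < #|S|]] p.
  rewrite (bigID (fun s => (enum_val s).2 \in D)) /=; congr (_ * _).
    under eq_bigr => s sD do rewrite mxE /glue_val sD exprMn.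
    rewrite big_split /=; congr (_ * _).
      rewrite (partition_big (fun s : 'I_#|S| => (enum_val s).1) xpredT) //=.
      apply: eq_bigr => i _; rewrite expr_sum; apply: eq_bigr => s /andP[_ /eqP->] //.
    rewrite (partition_big (fun s : 'I_#|S| => (enum_val s).2) xpredT) //=.
    apply: eq_bigr => j _; rewrite expr_sum; apply: eq_bigr => s /andP[_ /eqP->] //.
  rewrite /eval mevalX [RHS](bigID (fun s => (enum_val s).2 \in D)) /= [X in _ = X * _]big1 ?mul1r.
    by apply: eq_bigr => s /negPf sD; rewrite mxE /glue_val mnmE sD.
  by move=> s sD; rewrite mnmE sD expr0.
rewrite !glueE; congr (_ * _ * _).
- apply: eq_bigr => i _; congr (_ ^+ _).
  have [iD|iD] := boolP (meets row_cols D i); last first.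
    by rewrite !big1 // => s /andP[/cell_meets sD /eqP si]; rewrite si (negPf iD) in sD.
  have eqP : (fun s : 'I_#|S| => ((enum_val s).2 \in D) && ((enum_val s).1 == i))
      =1 (fun s => (enum_val s).1 == i).
    by move=> s; rewrite -cell_meetsE; case: eqP => [->|]; rewrite ?iD ?andbF.
  by rewrite !(eq_bigl _ _ eqP); apply: sum_Posz_eq; exact: kr.
- apply: eq_bigr => j _; congr (_ ^+ _).
  have [jD|jD] := boolP (j \in D); last first.
    by rewrite !big1 // => s /andP[sD /eqP sj]; rewrite -sj sD in jD.
  have eqP : (fun s : 'I_#|S| => ((enum_val s).2 \in D) && ((enum_val s).2 == j))
      =1 (fun s => (enum_val s).2 == j).
    by move=> s; case: eqP => [->|]; rewrite ?jD ?andbF.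
  by rewrite !(eq_bigl _ _ eqP); apply: sum_Posz_eq; exact: kc.
(* Erasing the columns of [D] preserves equality of margins, because a row has either all or none of
   its cells there. *)
pose cut (e : 'X_{1..#|S|}) :=
  [multinom (if (enum_val s).2 \in D then 0 else e s)%N | s < #|S|].
apply/eqP; rewrite -subr_eq0 -!/(cut _) /eval -mevalB; apply/eqP; apply: ptoric.
exists [:: (1, 'X_[cut a] - 'X_[cut b])]; split; last by rewrite big_seq1 mul1r.
move=> q'; rewrite inE => /eqP-> /=; exists (cut a), (cut b); split=> // k.
have : forall k, \sum_s (quasi_independence_mx S k s)%:~R * ((cut a s)%:Z - (cut b s)%:Z) = 0.
  apply/qi_kernelP; split=> [i |j].
    have [iD|iD] := boolP (meets row_cols D i).
      by apply: big1 => s /eqP si; rewrite !mnmE -cell_meetsE si iD subrr.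
    rewrite -[RHS](kr i); apply: eq_bigr => s /eqP si.
    by rewrite !mnmE -cell_meetsE si (negPf iD).
  have [jD|jD] := boolP (j \in D).
    by apply: big1 => s /eqP sj; rewrite !mnmE sj jD subrr.
  rewrite -[RHS](kc j); apply: eq_bigr => s /eqP sj.
  by rewrite !mnmE sj (negPf jD).
by move=> /(_ k) kerk; rewrite -[RHS]kerk; apply: eq_bigr => s _; rewrite intz.
Qed.

Lemma glue_row i : rsum (u^~ 0) i = Defs.total u * rsum (glue^~ 0) i.
Proof.
have [_ _ _ /qi_critP[pr _]] := pcrit.
have [iD|iD] := boolP (meets row_cols D i).
  rewrite rowE // -(rsum_cells (fun c => x c.1 * y c.2)); congr (_ * _).
  by apply: eq_bigr => s /eqP si; rewrite mxE /glue_val -cell_meetsE si iD.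
rewrite pr; congr (_ * _).
by apply: eq_bigr => s /eqP si; rewrite mxE /glue_val -cell_meetsE si (negPf iD).
Qed.

Lemma glue_col j : csum (u^~ 0) j = Defs.total u * csum (glue^~ 0) j.
Proof.
have [_ _ _ /qi_critP[_ pc]] := pcrit.
have [jD|jD] := boolP (j \in D).
  rewrite colE // -(csum_cells (fun c => x c.1 * y c.2)); congr (_ * _).
  by apply: eq_bigr => s /eqP sj; rewrite mxE /glue_val sj jD.
rewrite pc; congr (_ * _).
by apply: eq_bigr => s /eqP sj; rewrite mxE /glue_val sj (negPf jD).
Qed.

Lemma glue_critical : critical_point (quasi_independence_mx S) u glue.
Proof.
have [p0 _ _ _] := pcrit; split.
- move=> s; rewrite mxE /glue_val; case: ifP => sD; last exact: p0.
  by rewrite mulf_neq0 ?x0 ?y0 ?cell_meetsE.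
(* The total of the glued point follows by summing the column equations. *)
- apply: (mulfI T0); rewrite mulr1 /Defs.total.
  have tot (w : 'I_#|S| -> C) : \sum_s w s = \sum_j csum w j.
    transitivity (\sum_(j in [set: 'I_n]) csum w j); last by apply: eq_bigl => j; rewrite in_setT.
    by rewrite -sum_csum; apply: eq_bigl => s; rewrite in_setT.
  rewrite -/(Defs.total u) !tot mulr_sumr [in RHS]/Defs.total tot.
  by apply: eq_bigr => j _; rewrite -glue_col.
- exact: glue_toric.
- by apply/qi_critP; split; [exact: glue_row|exact: glue_col].
Qed.

End Glue.
End Margins.

(** * From ML-degree one to the exchange property *)

Section MLDegreeOne.
Variables (R : realType) (m n : nat) (S : {set 'I_m * 'I_n}).
Local Notation N := (row_cols S).

Lemma sum_rsum (V : nmodType) (w : 'I_#|S| -> V) (D : {set 'I_n}) :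
  closed_cols N D ->
  \sum_(s | (enum_val s).2 \in D) w s = \sum_(i | meets N D i) rsum w i.
Proof.
move=> cD; rewrite (partition_big (fun s : 'I_#|S| => (enum_val s).1) (meets N D)) /=.
  apply: eq_bigr => i iD; apply: eq_bigl => s; rewrite -cell_meetsE //.
  by case: eqP => [->|]; rewrite ?andbF // andbT.
by move=> s; rewrite cell_meetsE.
Qed.

Lemma rsumD (V : nmodType) (w w' : 'I_#|S| -> V) i :
  rsum (fun s => w s + w' s) i = rsum w i + rsum w' i.
Proof. exact: big_split. Qed.

Lemma csumD (V : nmodType) (w w' : 'I_#|S| -> V) j :
  csum (fun s => w s + w' s) j = csum w j + csum w' j.
Proof. exact: big_split. Qed.

Definition cell (c : 'I_m * 'I_n) (s : 'I_#|S|) : int := (enum_val s == c)%:R.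

Lemma rsum_cell i j i' : j \in N i -> rsum (cell (i, j)) i' = (i' == i)%:R.
Proof.
move=> jN; rewrite (rsum_cells S (fun c => (c == (i, j))%:R : int)).
have [->|ne] := eqVneq i' i; last first.
  by apply: big1 => k _; rewrite xpair_eqE (negPf ne).
rewrite (bigD1 j) //= eqxx big1 ?addr0 // => k /andP[_ /negPf kj].
by rewrite xpair_eqE kj andbF.
Qed.

Lemma csum_cell i j j' : j \in N i -> csum (cell (i, j)) j' = (j' == j)%:R.
Proof.
move=> jN; rewrite (csum_cells S (fun c => (c == (i, j))%:R : int)).
have [->|ne] := eqVneq j' j; last first.
  by apply: big1 => k _; rewrite xpair_eqE (negPf ne) andbF.
rewrite (bigD1 i) //= eqxx big1 ?addr0 // => k /andP[_ /negPf ki].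
by rewrite xpair_eqE ki.
Qed.

Lemma rsumN (w : 'I_#|S| -> int) i : rsum (fun s => - w s) i = - rsum w i.
Proof. exact: sumrN. Qed.

Lemma csumN (w : 'I_#|S| -> int) j : csum (fun s => - w s) j = - csum w j.
Proof. exact: sumrN. Qed.

(* An alternating path from column j to the root row i0 has these margins. *)
Definition col_flow i0 j (f : 'I_#|S| -> int) :=
  (forall i, rsum f i = (i == i0)%:R) /\ (forall k, csum f k = (k == j)%:R).

(** The columns admitting a flow form a closed set: to pass from [k] to [l] along a row [i], add the
    cell [(i, l)] and subtract the cell [(i, k)]. *)
Lemma col_flow_exists i0 j : j \in cl N (N i0) -> exists f, col_flow i0 j f.
Proof.
pose D := [set j | boolp.asbool (exists f, col_flow i0 j f)].
suff /subsetP sD : cl N (N i0) \subset D by move=> /sD; rewrite inE => /boolp.asboolP.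
apply: cl_min.
  apply/forallP => i; apply/implyP => /set0Pn[k /setIP[kN]].
  rewrite inE => /boolp.asboolP[f [fr fc]]; apply/subsetP => l lN; rewrite inE.
  apply/boolp.asboolP; exists (fun s => f s + (cell (i, l) s - cell (i, k) s)).
  split=> h; [rewrite rsumD rsumD rsumN !rsum_cell // fr|rewrite csumD csumD csumN !csum_cell // fc].
    by rewrite subrr addr0.
  by rewrite addrC subrK.
apply/subsetP => k kN; rewrite inE; apply/boolp.asboolP; exists (cell (i0, k)).
by split=> h; rewrite ?rsum_cell ?csum_cell.
Qed.

(** The sum of the flows of all columns makes the column margins positive. For each row [i], the
    flow of one of its columns [j] minus the cell [(i, j)] moves one unit from row [i] to the root
    and leaves the column margins alone. *)
Lemma flow_exists i0 : exists f : 'I_#|S| -> int,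
  (forall j, j \in cl N (N i0) -> 0 < csum f j) /\
  (forall i, meets N (cl N (N i0)) i -> i != i0 -> rsum f i < 0).
Proof.
set D := cl N (N i0).
have /fin_all_exists[fc fcP] : forall j, exists f, j \in D -> col_flow i0 j f.
  move=> j; have [/col_flow_exists[f]|_] := boolP (j \in D); first by exists f.
  by exists (fun=> 0).
have /fin_all_exists[fr frP] : forall i, exists f : 'I_#|S| -> int, meets N D i ->
    (forall k, rsum f k = (k == i0)%:R - (k == i)%:R) /\ (forall k, csum f k = 0).
  move=> i; have [/set0Pn[j /setIP[jN /fcP[jr jc]]]|_] := boolP (meets N D i); last by exists (fun=> 0).
  exists (fun s => fc j s - cell (i, j) s) => _.
  split=> k; [rewrite rsumD rsumN jr rsum_cell //|rewrite csumD csumN jc csum_cell //].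
  by rewrite subrr.
pose f s := \sum_(j in D) fc j s + \sum_(i | meets N D i) fr i s.
have rf k : rsum f k = \sum_(j in D) rsum (fc j) k + \sum_(i | meets N D i) rsum (fr i) k.
  by rewrite /rsum big_split /= exchange_big /=; congr (_ + _); rewrite exchange_big.
have cf k : csum f k = \sum_(j in D) csum (fc j) k + \sum_(i | meets N D i) csum (fr i) k.
  by rewrite /csum big_split /= exchange_big /=; congr (_ + _); rewrite exchange_big.
exists f; split=> [j jD|i iD ii0].
  rewrite cf (bigD1 j) //= (fcP _ jD).2 eqxx big1 => [|k /andP[kD /negPf kj]].
    by rewrite big1 => // i iD; rewrite (frP _ iD).2.
  by rewrite (fcP _ kD).2 eq_sym kj.
rewrite rf big1 => [|j jD]; last by rewrite (fcP _ jD).1 (negPf ii0).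
rewrite add0r (bigD1 i) //= (frP _ iD).1 (negPf ii0) eqxx big1 => [|k /andP[kD /negPf ki]] //.
by rewrite (frP _ kD).1 (negPf ii0) eq_sym ki.
Qed.

Lemma span_root_neq0 i0 K i : span N i0 K -> meets N K i -> N i0 != set0.
Proof.
move=> sK; apply: contraTneq => N0.
suff -> : K = set0 by rewrite /meets setI0 eqxx.
elim: sK => // {}K k _ IH; rewrite /meets IH // setI0 eqxx //.
Qed.

(** Generic data far along the flow direction have margins of the signs required by the
    maximization. Were the rows to differ on [K], two regions would give critical points for the
    same data with different values at one cell. *)
Theorem ml_degree1_exchange i0 K i1 i2 a :
  ml_degree R[i] (quasi_independence_mx S) 1 ->
  span N i0 K -> a \in N i1 -> a \in N i2 -> a \notin K ->
  meets N K i1 -> meets N K i2 -> N i1 :&: K = N i2 :&: K.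
Proof.
move=> /ml_degree1_unique[g g0 uniq_crit] sK a1 a2 aK m1 m2.
apply/eqP; apply: contraT => ne12.
have N0 := span_root_neq0 sK m1.
have [y1 [y2 [i [gy1 gy2 ai iD sgne]]]] := two_regions R N0 sK a1 a2 aK m1 m2 ne12.
set D := cl N (N i0) in gy1 gy2 iD.
have cD : closed_cols N D := cl_closed _ _.
have aD : a \in D.
  by move/forallP/(_ i)/implyP/(_ iD)/subsetP: cD; apply.
have [f [fc fr]] := flow_exists i0; rewrite -/D in fc fr.
(* Genericity is strengthened so that the total of the data is nonzero. *)
pose tot : {mpoly R[i][#|S|]} := \sum_s 'X_s.
have tot0 : tot != 0.
  have iaS : (i, a) \in S by rewrite inE in ai.
  have s0 := enum_rank_in iaS (i, a).
  apply: contraT => /negPn/eqP/(congr1 (mcoeff U_(s0))); rewrite mcoeff0 /tot raddf_sum /=.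
  rewrite (bigD1 s0) //= mcoeffX eqxx big1 ?addr0 => [|s /negPf ss0].
    by move/eqP; rewrite oner_eq0.
  by rewrite mcoeffX eq_mnm1 ss0.
have [v vP] := mpoly_line_neq0 f (mulf_neq0 g0 tot0).
(* Beyond this bound the flow outweighs the contribution of [v] to every row margin. *)
pose M0 := (\sum_s v s)%N.
have [M M0M gU] := vP M0.+1.
pose U s : int := (v s)%:Z + M%:Z * f s.
pose u : 'cV[R[i]]_#|S| := \col_s (U s)%:~R.
have uE s : u s 0 = (U s)%:~R by rewrite mxE.
have evalE h : eval h u = h.@[fun s => (U s)%:~R] by apply: meval_eq => s.
move: gU; rewrite -evalE /eval mevalM mulf_eq0 negb_or => /andP[gu totu].
have T0 : Defs.total u != 0.
  by move: totu; rewrite /tot raddf_sum /=; under eq_bigr do rewrite mevalXU.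
have [p pcrit puniq] := uniq_crit u gu.
have csumU j : csum U j = (\sum_(s | (enum_val s).2 == j) v s)%:Z + M%:Z * csum f j.
  rewrite /csum big_split /= -mulr_sumr; congr (_ + _).
  by rewrite -[RHS]intz sumMz; apply: eq_bigr => s _; rewrite intz.
have rsumU k : rsum U k = (\sum_(s | (enum_val s).1 == k) v s)%:Z + M%:Z * rsum f k.
  rewrite /rsum big_split /= -mulr_sumr; congr (_ + _).
  by rewrite -[RHS]intz sumMz; apply: eq_bigr => s _; rewrite intz.
have rsumu k : rsum (u^~ 0) k = (rsum U k)%:~R.
  by rewrite /rsum rmorph_sum; apply: eq_bigr => s _; rewrite uE.
have csumu j : csum (u^~ 0) j = (csum U j)%:~R.
  by rewrite /csum rmorph_sum; apply: eq_bigr => s _; rewrite uE.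
have cU j : j \in D -> 0 < csum U j.
  by move=> /fc jf; rewrite csumU ltr_wpDl // mulr_gt0 // ltz_nat (leq_trans _ M0M).
have rU k : meets N D k -> k != i0 -> rsum U k < 0.
  move=> kD k0; have := fr k kD k0; rewrite rsumU.
  have : (\sum_(s | (enum_val s).1 == k) v s <= M0)%N.
    by rewrite /M0 [X in (_ <= X)%N](bigID (fun s => (enum_val s).1 == k)) leq_addr.
  move: (\sum_(s | _) _)%N => t tM fk.
  have : M%:Z * rsum f k <= - M%:Z by rewrite -mulrN1 ler_wpM2l // -ltzD1 addNr.
  move: M0M; clear -tM => M0M le; apply: le_lt_trans (lerD (lexx _) le) _.
  by rewrite subr_lt0 ltz_nat (leq_ltn_trans tM).
pose c j := `|csum U j|%N.
pose e k := `|rsum U k|%N.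
have c_gt0 j : j \in D -> (0 < c j)%N by move=> /cU jU; rewrite absz_gt0 gt_eqF.
have e_gt0 k : meets N D k -> k != i0 -> (0 < e k)%N 
  by move=> kD /(rU k kD) kU; rewrite absz_gt0 lt_eqF.
pose r k : R := if k == i0
  then (\sum_(j in D) c j + \sum_(k | meets N D k && (k != i0)) e k)%:R
  else - (e k)%:R.
have cE j : j \in D -> (c j)%:R = (csum U j)%:~R :> R.
  by move=> /cU jU; rewrite /c -[RHS](ger0_norm) ?ler0z ?ltW // -intr_norm -abszE.
have eE k : meets N D k -> k != i0 -> (e k)%:R = - (rsum U k)%:~R :> R.
  move=> kD k0; rewrite -mulrNz -(ltr0_norm (rU k kD k0)) -abszE.
  by rewrite -pmulrn.
have N0D : N i0 \subset D by exact: sub_cl.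
have i0D : meets N D i0.
  by case/set0Pn: N0 => j jN; apply/set0Pn; exists j; rewrite inE jN (subsetP N0D).
(* The root exponent is a row margin too, since the rows and the columns of the component have the
   same total. *)
have rE k : meets N D k -> r k = (rsum U k)%:~R.
  move=> kD; rewrite /r; have [->|k0] := eqVneq k i0; last by rewrite eE ?opprK.
  rewrite natrD !natr_sum (eq_bigr _ cE).
  rewrite (eq_bigr (fun k => - (rsum U k)%:~R)) => [|h /andP[hD h0]]; last exact: eE.
  rewrite sumrN -!(rmorph_sum (intmul 1)) -rmorphB /= -sum_csum (sum_rsum _ cD).
  by rewrite (bigD1 i0) //= addrK.
have r_neq0 k : meets N D k -> r k != 0.
  move=> kD; have [->|k0] := eqVneq k i0; last by rewrite rE // intr_eq0 lt_eqF ?rU.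
  rewrite /r eqxx pnatr_eq0 (bigD1 a) //= -addnA -lt0n addn_gt0.
  by rewrite c_gt0.
(* With x_i = r_i / l_i(z) the row equations hold by construction, and the column equations are
   those of [critical_solution]. *)
have crit y : region N i0 y D -> exists z, [/\ forall j, j \in D -> 0 < y j * z j,
    forall k, meets N D k -> 0 < ell N y k * ell N z k &
    critical_point (quasi_independence_mx S) u
      (glue p D (fun k => (r k / ell N z k)%:C%C)
                (fun j => (z j)%:C%C / Defs.total u))].
  move=> gy; have [z [zD zI z1 zcol]] := critical_solution N0 gy cD c_gt0 e_gt0.
  rewrite -/r in zcol.
  have ell_neq0 k : meets N D k -> ell N z k != 0.
    by move/zI; apply: contraTneq => ->; rewrite mulr0 ltxx.
  exists z; split=> //; apply: glue_critical => //.
  - by move=> k kD; rewrite fmorph_eq0 mulf_neq0 ?invr_neq0 ?r_neq0 ?ell_neq0.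
  - move=> j jD; rewrite mulf_neq0 ?invr_neq0 // fmorph_eq0.
    by move: (zD j jD); apply: contraTneq => ->; rewrite mulr0 ltxx.
  - move=> k kD; rewrite rsumu -(rmorph_int (real_complex R)) -rE //.
    under eq_bigr do rewrite mulrA; rewrite -mulr_suml -mulr_sumr -rmorph_sum.
    rewrite mulrCA divff // mulr1 -rmorphM /=; congr (_%:C%C).
    by rewrite -/(ell N z k) divfK ?ell_neq0.
  - move=> j jD; rewrite csumu -(rmorph_int (real_complex R)) -cE // -zcol //.
    rewrite [in RHS](eq_bigr (fun i => (r i / ell N z i * z j)%:C%C / Defs.total u)) => [|k _].
      by rewrite -[in RHS]mulr_suml -(rmorph_sum (real_complex R)) mulrCA divff // mulr1.
    by rewrite mulrA -rmorphM.
have [z1 [z1D z1I /puniq p1]] := crit _ gy1.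
have [z2 [z2D z2I /puniq p2]] := crit _ gy2.
have iaS : (i, a) \in S by rewrite inE in ai.
have : glue_val p D (fun k => (r k / ell N z1 k)%:C%C)
                (fun j => (z1 j)%:C%C / Defs.total u) (enum_rank_in iaS (i, a)) =
       glue_val p D (fun k => (r k / ell N z2 k)%:C%C)
                (fun j => (z2 j)%:C%C / Defs.total u) (enum_rank_in iaS (i, a)).
  have := congr1 (fun q : 'cV_#|S| => q (enum_rank_in iaS (i, a)) 0) (etrans p1 (esym p2)).
  by rewrite !mxE.
rewrite /glue_val enum_rankK_in //= aD !mulrA => /(mulIf (invr_neq0 T0)).
rewrite -!rmorphM => /complexI.
rewrite -!mulrA => /(mulfI (r_neq0 i iD)) eqz.
case/eqP: sgne.
(* As [z] has the signs of [y], the ratio z_a / l_i(z) has the sign of [y a * ell N y i]; equal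
   ratios therefore contradict the choice of the two regions. *)
have sgy (y z : 'I_n -> R) : 0 < y a * z a -> 0 < ell N y i * ell N z i ->
    Num.sg (y a * ell N y i) = Num.sg ((ell N z i)^-1 * z a).
  move=> ya yi.
  have [ya0 _] : y a != 0 /\ z a != 0.
    by apply/andP; rewrite -negb_or -mulf_eq0 gt_eqF.
  have [yi0 zi0] : ell N y i != 0 /\ ell N z i != 0.
    by apply/andP; rewrite -negb_or -mulf_eq0 gt_eqF.
  have -> : (ell N z i)^-1 * z a =
      (y a * ell N y i) * ((y a * z a) / (ell N y i * ell N z i) / y a ^+ 2).
    by field; rewrite zi0 ya0 yi0.
  rewrite [RHS]sgrM [X in _ = _ * X]gtr0_sg ?mulr1 //.
  by rewrite !divr_gt0 // exprn_even_gt0.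
by rewrite (sgy _ _ (z1D a aD) (z1I i iD)) (sgy _ _ (z2D a aD) (z2I i iD)) eqz.
Qed.

End MLDegreeOne.
(** * The exchange property and its consequences for the bipartite graph *)

Section Elimination.
Variables (I : finType) (n : nat) (N : I -> {set 'I_n}).
Implicit Types (K : {set 'I_n}) (i : I) (j : 'I_n).

Definition exchange := forall i0 K i1 i2 a, span N i0 K ->
  a \in N i1 -> a \in N i2 -> a \notin K -> meets N K i1 -> meets N K i2 ->
  N i1 :&: K = N i2 :&: K.

(** A Boolean form of the inductive predicate, so that a span of maximal size can be selected. *)
Definition spanb K := boolp.asbool (exists i0, N i0 != set0 /\ span N i0 K).

Definition open_span K := spanb K && ~~ closed_cols N K.

Lemma not_open i0 K i : span N i0 K -> N i0 != set0 -> ~~ open_span K ->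
  meets N K i -> N i \subset K.
Proof.
move=> sK N0; rewrite /open_span negb_and negbK => /orP[/boolp.asboolPn[]|/forallP/(_ i)/implyP]//.
by exists i0.
Qed.

Lemma meets_mem K i j : j \in N i -> j \in K -> meets N K i.
Proof. by move=> ji jK; apply/set0Pn; exists j; rewrite inE ji. Qed.

(** Take a largest span [K] that is not closed. Two rows leaving [K] have the same columns outside
    [K], and agree on [K] by exchange, so they are twins. If only row [i] leaves [K], the other rows
    meeting [N i :\: K] lie inside it: a smallest of them has a single column or contains twin
    columns, and if there is none, a column of [i] has a single cell. *)
Lemma elimination i0 : exchange -> N i0 != set0 ->
  [\/ exists i j, N i = [set j],
      exists i j, forall k, (j \in N k) = (k == i),
      exists i i', [/\ i != i', N i = N i' & N i != set0] |
      exists j j' i, [/\ j != j', j \in N i & forall k, (j \in N k) = (j' \in N k)]].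
Proof.
move=> exN N0.
have [/existsP[K1 oK1]|noopen] := boolP [exists K, open_span K]; last first.
  (* Without open spans, rows that meet are equal: either [i0] has a twin, or its columns have a
     single cell. *)
  have closedN i k : N i != set0 -> meets N (N i) k -> N k \subset N i.
    move=> Ni; apply: (not_open (span_row _ i) Ni).
    by apply: contraNN noopen => ?; apply/existsP; exists (N i).
  have [/existsP[i1 /andP[ne1 m1]]|alone] :=
      boolP [exists i, (i != i0) && meets N (N i0) i].
    apply: Or43; exists i1, i0; split=> //.
      apply/eqP; rewrite eqEsubset closedN //= closedN //; last by rewrite /meets setIC.
      by apply: contraTneq m1 => N1; rewrite /meets N1 set0I eqxx.
    by apply: contraTneq m1 => N1; rewrite /meets N1 set0I eqxx.
  case/set0Pn: N0 => j jN; apply: Or42; exists i0, j => k.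
  apply/idP/eqP => [jk|-> //]; apply/eqP; apply: contraNT alone => ki.
  by apply/existsP; exists k; rewrite ki (meets_mem jk).
case: (@arg_maxnP _ K1 open_span (fun K => #|K|) oK1) => K oK maxK {K1 oK1}.
case/andP: (oK) => /boolp.asboolP[r [r0 sK]] /forallPn[i ].
rewrite negb_imply => /andP[iK niK].
(* By maximality of [K], adding a row that leaves [K] yields a closed set. *)
have bigger k : meets N K k -> ~~ (N k \subset K) ->
    forall l, meets N (K :|: N k) l -> N l \subset K :|: N k.
  move=> kK nkK l; apply: (not_open (span_step sK kK) r0).
  apply/negP => /maxK; apply/negP; rewrite -ltnNge; apply: proper_card.
  by rewrite properE subsetUl subUset subxx.
have meetsUl k l : meets N K l -> meets N (K :|: N k) l by apply: meetsS; exact: subsetUl.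
have [/existsP[k /and3P[ki kK nkK]]|only] :=
    boolP [exists k, [&& k != i, meets N K k & ~~ (N k \subset K)]].
  apply: Or43; exists k, i.
  have /subsetPn[a aNi aK] := niK.
  have diff l l' : meets N K l -> ~~ (N l \subset K) -> meets N K l' ->
      forall b, b \notin K -> b \in N l' -> b \in N l.
    move=> lK nlK l'K b bK bl'; have := bigger l lK nlK l' (meetsUl l l' l'K).
    by move=> /subsetP/(_ b bl'); rewrite inE (negPf bK).
  have eqK := exN _ _ _ _ _ sK (diff _ _ kK nkK iK a aK aNi) aNi aK kK iK.
  split=> //.
    apply/setP=> b; have [bK|bK] := boolP (b \in K).
      by have /setP/(_ b) := eqK; rewrite !inE bK !andbT.
    by apply/idP/idP; apply: diff bK.
  by apply: contraTneq kK => Nk; rewrite /meets Nk set0I eqxx.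
have onlyi k : meets N K k -> ~~ (N k \subset K) -> k = i.
  move=> kK nkK; apply/eqP; apply: contraNT only => ki.
  by apply/existsP; exists k; rewrite ki kK.
set Z := N i :\: K.
have subZ k j : j \in Z -> j \in N k -> k != i -> N k \subset Z.
  move=> jZ jk ki; have /setDP[ji jK] := jZ.
  have knK : ~~ meets N K k.
    apply: contraNN ki => kK; apply/eqP/onlyi => //.
    by apply/subsetPn; exists j.
  apply/subsetP=> b bk; rewrite inE.
  have bK : b \notin K by apply: contraNN knK; exact: meets_mem.
  have := bigger i iK niK k; rewrite bK /= => /(_ _)/subsetP/(_ b bk).
  rewrite inE (negPf bK) /=; apply.
  by apply: (meets_mem jk); rewrite inE ji orbT.
have /subsetPn[a aNi aK] := niK.
have aZ : a \in Z by rewrite inE aK.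
pose G k := (k != i) && meets N Z k.
have [/existsP[g0 Gg0]|noG] := boolP [exists k, G k]; last first.
  apply: Or42; exists i, a => k; apply/idP/eqP => [ak|-> //].
  apply/eqP; apply: contraNT noG => ki; apply/existsP; exists k.
  by rewrite /G ki (meets_mem ak).
case: (@arg_minnP _ g0 G (fun k => #|N k|) Gg0) => g /andP[gi gZ] ming.
case/set0Pn: (gZ) => x1 /setIP[x1g x1Z].
have gsub : N g \subset Z by apply: subZ gi; eassumption.
have [gE|] := eqVneq (N g) [set x1]; first by apply: Or41; exists g, x1.
rewrite eqEsubset sub1set x1g andbT => /subsetPn[x2 x2g]; rewrite inE => x21.
have N0g : meets N (N g) i.
  by apply: (meets_mem _ x1g); case/setDP: x1Z.
(* A row [h] containing [x] but not [x'] has, by minimality of [g], a column [x3] outside [N g].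
   Exchange over [N g] for the rows [h] and [i], which share [x3], forces [h] to contain all of
   [N g]. *)
have both h x x' : x \in N g -> x' \in N g -> x \in N h -> x' \in N h.
  move=> xg x'g xh.
  have x'i : x' \in N i by have /(subsetP gsub)/setDP[] := x'g.
  have [->|hi] := eqVneq h i; first exact: x'i.
  apply: contraT => x'h.
  have hZ : N h \subset Z by apply: (subZ _ x) => //; exact: (subsetP gsub).
  have Gh : G h by rewrite /G hi (meets_mem xh) // (subsetP gsub).
  have /subsetPn[x3 x3h x3g] : ~~ (N h \subset N g).
    apply/negP => hg; have := ming h Gh; rewrite leqNgt; apply/negP; rewrite negbK.
    by apply: proper_card; rewrite properE hg; apply/subsetPn; exists x'.
  have x3i : x3 \in N i by have /(subsetP hZ)/setDP[] := x3h.
  have := exN _ _ _ _ _ (span_row N g) x3h x3i x3g (meets_mem xh xg) N0g.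
  by move/setP/(_ x'); rewrite !inE x'g x'i (negPf x'h).
apply: Or44; exists x1, x2, g; split; rewrite 1?eq_sym // => h.
by apply/idP/idP; apply: both.
Qed.

End Elimination.
Section ExchangeRestrict.
Variables (I : finType) (n : nat) (N N' : I -> {set 'I_n}).
Variables (P : pred I) (D : {set 'I_n}).
Hypothesis N'E : forall i, N' i = if P i then N i :&: D else set0.

(** A span of the restricted system is the trace on [D] of a span of the original one, so exchange
    is applied there and intersected with [D]. A root row outside [P] spans the empty set, which no
    row meets. *)
Lemma exchange_restrict : exchange N -> exchange N'.
Proof.
move=> exN i0 K' i1 i2 a sK'.
have memN' i j : j \in N' i -> [/\ P i, j \in N i & j \in D].
  by rewrite N'E; case: (P i); rewrite inE // => /andP[].
have [Pi0|nPi0] := boolP (P i0); last first.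
  have -> : K' = set0.
    elim: sK' => [|K i _ -> ]; first by rewrite N'E (negPf nPi0).
    by rewrite /meets setI0 eqxx.
  by rewrite /meets setI0 eqxx.
have [K sK ->] : exists2 K, span N i0 K & K' = K :&: D.
  elim: sK' => [|{}K' i _ [K sK ->] m]; first by exists (N i0); [exact: span_row|rewrite N'E Pi0].
  case/set0Pn: m => j /setIP[/memN'[Pi ji jD]] /setIP[jK _].
  exists (K :|: N i); last by rewrite N'E Pi setIUl.
  by apply: span_step => //; apply: meets_mem ji jK.
move=> /memN'[P1 a1 aD] /memN'[P2 a2 _]; rewrite inE aD andbT => aK.
have up i : meets N' (K :&: D) i -> meets N K i.
  by case/set0Pn=> j /setIP[/memN'[_ ji _]] /setIP[jK _]; apply: meets_mem ji jK.
move=> /up m1 /up m2; have := exN _ _ _ _ _ sK a1 a2 aK m1 m2.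
by rewrite !N'E P1 P2 -!setIA ![D :&: _]setIC -!setIA setIid !setIA => ->.
Qed.

End ExchangeRestrict.

(** * Labelings of the cells realizing iterated toric fiber products *)

Section TFPData.
Variables (m n : nat).
Local Notation T := ('I_m * 'I_n)%type.
Implicit Types (S : {set T}) (s t : T) (b g : nat -> T -> nat).

Definition same_prefix b r s t := [forall q : 'I_r.+1, b q t == b q s].

Definition weight S (x : 'I_m -> nat) (y : 'I_n -> nat) (P : pred T) : nat :=
  \sum_(t in S | P t) x t.1 * y t.2.

Definition null_on S (b : T -> nat) (u : T -> int) :=
  forall l, \sum_(s in S | b s == l) u s = 0.

Definition null_margins S (u : T -> int) :=
  (forall i, \sum_(s in S | s.1 == i) u s = 0) /\
  (forall j, \sum_(s in S | s.2 == j) u s = 0).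

(* b r labels the columns of the block r, and g r is the class function of the
   fiber product that adds block r.+1.  The last field says that, for weights in
   the model, the prefix up to r and the label b r.+1 are independent given g r.
   Only the counting measure matters in the end, but twin rows have to be merged
   into a row of double weight. *)
Record tfp_data S (h : nat) b g : Prop := TFPData {
  tfp_next : forall r u, (r < h)%N -> null_on S (b r.+1) u -> null_on S (g r) u;
  tfp_prefix : forall r u, (r < h)%N ->
    (forall q, (q <= r)%N -> null_on S (b q) u) -> null_on S (g r) u;
  tfp_kernel : forall u,
    (forall q, (q <= h)%N -> null_on S (b q) u) <-> null_margins S u;
  tfp_weight : forall r x y s s', (r < h)%N -> s \in S -> s' \in S -> g r s = g r s' ->
    (weight S x y (fun t => same_prefix b r s t && (b r.+1 t == b r.+1 s')) *
       weight S x y (fun t => g r t == g r s) =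
     weight S x y (same_prefix b r s) *
       weight S x y (fun t => b r.+1 t == b r.+1 s'))%N }.

Definition tfp S := exists h b g, tfp_data S h b g.

Lemma same_prefixP b r s t :
  reflect (forall q, (q <= r)%N -> b q t = b q s) (same_prefix b r s t).
Proof.
apply: (iffP forallP) => [H q qr|H q]; last by rewrite H // -ltnS.
by have /eqP := H (Ordinal (qr : (q < r.+1)%N)).
Qed.

Lemma tfp0 : tfp set0.
Proof.
exists 0%N, (fun _ _ => 0%N), (fun _ _ => 0%N); split=> // u; split=> [_|_ q _ l].
  by split=> i; rewrite big_pred0 // => s; rewrite inE.
by rewrite big_pred0 // => s; rewrite inE.
Qed.

(** Otherwise the difference of the indicators of [s] and [t] would be killed by all blocks and
    hence have null margins, which is impossible for distinct cells. *)
Lemma tfp_inj S h b g s t : tfp_data S h b g -> s \in S -> t \in S ->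
  (forall q, (q <= h)%N -> b q t = b q s) -> t = s.
Proof.
move=> [_ _ ker _] sS tS bE; apply/eqP; apply: contraT => ts.
pose u (c : T) : int := (c == s)%:R - (c == t)%:R.
have sumu (P : pred T) : \sum_(c in S | P c) u c = (P s)%:R - (P t)%:R.
  have delta c0 : c0 \in S -> \sum_(c in S | P c) ((c == c0)%:R : int) = (P c0)%:R.
    move=> c0S; rewrite big_mkcond /= (bigD1 c0) //= c0S eqxx /= big1 ?addr0.
      by case: (P c0).
    by move=> c /negPf->; rewrite if_same.
  by rewrite sumrB !delta.
have [|r c] := (ker u).1.
  by move=> q qh l; rewrite sumu bE // subrr.
have := r s.1; have := c s.2; rewrite !sumu !eqxx.
case: eqP => // e2; case: eqP => // e1 _ _.
by case/eqP: ts; case: s t e1 e2 {sS tS bE u sumu r c} => [? ?] [? ?] /= -> ->.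
Qed.

(** * Adding a free cell *)

Section AddPoint.
Variables (S : {set T}) (s0 : T).
Hypothesis s0S : s0 \notin S.
Hypothesis null_s0 : forall u, null_margins (s0 |: S) u -> u s0 = 0.

Lemma sum_add_point (V : nmodType) (P : pred T) (F : T -> V) :
  \sum_(s in s0 |: S | P s) F s =
  (if P s0 then F s0 else 0) + \sum_(s in S | P s) F s.
Proof. by rewrite big_mkcondr big_setU1 //= -big_mkcondr. Qed.

Definition add_label (b : nat -> T -> nat) q s :=
  if s == s0 then 0%N else (b q s).+1.

Lemma sum_add_label (V : nmodType) (b : nat -> T -> nat) q l (F : T -> V) :
  \sum_(s in s0 |: S | add_label b q s == l) F s =
  if l is l'.+1 then \sum_(s in S | b q s == l') F s else F s0.
Proof.
rewrite sum_add_point /add_label eqxx.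
have -> : \sum_(s in S | (if s == s0 then 0%N else (b q s).+1) == l) F s =
    \sum_(s in S | (b q s).+1 == l) F s.
  apply: eq_bigl => s; case sS: (s \in S) => //=.
  by case: (eqVneq s s0) => // ss0; move: s0S; rewrite -ss0 sS.
case: l => [|l]; first by rewrite eqxx big_pred0 ?addr0 // => s; rewrite andbF.
by rewrite add0r.
Qed.

Lemma null_add_label b q u :
  null_on (s0 |: S) (add_label b q) u <-> u s0 = 0 /\ null_on S (b q) u.
Proof.
split=> [H|[u0 H] [|l]]; last by rewrite sum_add_label.
  split=> [|l]; first by have := H 0%N; rewrite sum_add_label.
  by have := H l.+1; rewrite sum_add_label.
by rewrite sum_add_label.
Qed.

Lemma null_margins_add u :
  null_margins (s0 |: S) u <-> u s0 = 0 /\ null_margins S u.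
Proof.
have E : u s0 = 0 -> forall P : pred T,
    \sum_(s in s0 |: S | P s) u s = \sum_(s in S | P s) u s.
  by move=> u0 P; rewrite sum_add_point u0 if_same add0r.
split=> [H|[u0 [r c]]]; last by split=> k; rewrite E.
by have u0 := null_s0 H; case: H => r c; split=> //; split=> k; rewrite -(E u0).
Qed.

(** With a label of its own in every block, [s0] is a class by itself. In the weight identity either
    all four weights are that of [s0], or [s0] contributes to none of them. *)
Lemma tfp_add_point : tfp S -> tfp (s0 |: S).
Proof.
case=> h [b [g [next pref ker wt]]].
exists h, (add_label b), (add_label g).
split.
- move=> r u rh /null_add_label[u0 bu]; apply/null_add_label; split=> //.
  exact: next.
- move=> r u rh bu; apply/null_add_label.
  have [u0 _] := (null_add_label _ _ _).1 (bu 0%N (leq0n _)); split=> //.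
  by apply: pref => // q /bu /null_add_label[].
- move=> u; split=> [bu|/null_margins_add[u0 mu] q qh]; last first.
    by apply/null_add_label; split=> //; apply: (ker u).2.
  have [u0 _] := (null_add_label _ _ _).1 (bu 0%N (leq0n _)).
  apply/null_margins_add; split=> //; apply/ker => q /bu.
  by case/null_add_label.
move=> r x y s s' rh; rewrite /weight !in_setU1.
have lab0 (c : nat -> T -> nat) q t : (add_label c q t == add_label c q s0) = (t == s0).
  by rewrite /add_label eqxx; case: (t == s0).
have neS t : t \in S -> (t == s0) = false.
  by move=> tS; apply: contraNF s0S => /eqP <-.
have pre0 t : same_prefix (add_label b) r s0 t = (t == s0).
  apply/forallP/eqP => [/(_ ord0)|-> q //]; by rewrite lab0 => /eqP.
have [-> _|ss0 /= sS] := eqVneq s s0.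
  have [-> _|s's0 /= s'S] := eqVneq s' s0; last first.
    by rewrite /add_label eqxx (negPf s's0).
  move=> _; have sum0 (P : pred T) : P =1 pred1 s0 ->
      (\sum_(t in s0 |: S | P t) x t.1 * y t.2 = x s0.1 * y s0.2)%N.
    move=> PE; rewrite (eq_bigl (pred1 s0)) ?big_pred1_eq // => t.
    by rewrite PE !inE; case: (t == s0); rewrite ?andbF ?andbT.
  rewrite !sum0 // => t /=; rewrite ?pre0 ?lab0 ?andbb //.
have [->|s's0 /= s'S] := eqVneq s' s0.
  by rewrite /add_label eqxx (negPf ss0).
rewrite {1 2}/add_label (negPf ss0) (negPf s's0) => -[gss'].
have := wt r x y s s' rh sS s'S gss'; rewrite /weight.
have sumE (P Q : pred T) : P s0 = false -> {in S, P =1 Q} ->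
    (\sum_(t in s0 |: S | P t) x t.1 * y t.2 = \sum_(t in S | Q t) x t.1 * y t.2)%N.
  move=> P0 PQ; rewrite [LHS](sum_add_point (V := nat)) P0 add0r.
  by apply: eq_bigl => t; case tS: (t \in S) => //=; rewrite PQ.
have labS (c : nat -> T -> nat) q t t' : t \in S -> t' != s0 ->
    (add_label c q t == add_label c q t') = (c q t == c q t').
  by move=> tS /negPf t'0; rewrite /add_label neS // t'0.
have lab0S (c : nat -> T -> nat) q t' : t' != s0 -> (add_label c q s0 == add_label c q t') = false.
  by move=> /negPf t'0; rewrite /add_label eqxx t'0.
have preS t : t \in S -> same_prefix (add_label b) r s t = same_prefix b r s t.
  by move=> tS; apply: eq_forallb => q; rewrite labS.
have pre0S : same_prefix (add_label b) r s s0 = false.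
  by apply/negbTE; rewrite negb_forall; apply/existsP; exists ord0; rewrite lab0S.
rewrite (sumE _ (fun t => same_prefix b r s t && (b r.+1 t == b r.+1 s'))) ?pre0S //; last first.
  by move=> t tS /=; rewrite preS // labS.
rewrite (sumE (fun t => add_label g r t == add_label g r s) (fun t => g r t == g r s)); last 2 first.
- exact: lab0S.
- by move=> t tS /=; rewrite labS.
rewrite (sumE _ (same_prefix b r s)) ?pre0S //.
rewrite (sumE _ (fun t => b r.+1 t == b r.+1 s')) ?lab0S // => t tS /=.
by rewrite labS.
Qed.

End AddPoint.

End TFPData.

(** * Duplicating a row *)

Section TwinRows.
Variables (m n : nat).
Local Notation T := ('I_m * 'I_n)%type.
Variables (S : {set T}) (i i' : 'I_m).
Hypothesis ii' : i != i'.
Hypothesis twin : forall j, ((i, j) \in S) = ((i', j) \in S).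

Definition drop_twin : {set T} := [set s in S | s.1 != i'].
Definition fold_twin (s : T) : T := if s.1 == i' then (i, s.2) else s.
(** Push-forward of [F] along [fold_twin], to be read on [drop_twin]. *)
Definition push_twin (V : nmodType) (F : T -> V) (s : T) : V :=
  F s + (if s.1 == i then F (i', s.2) else 0).
(** Labels of the extra block, which separates the twins and lumps the other rows together. *)
Definition twin_code (s : T) : nat :=
  if s.1 == i then 1%N else if s.1 == i' then 2%N else 0%N.

Lemma sum_push_twin (V : nmodType) (P : pred T) (F : T -> V) :
  \sum_(s in S | P (fold_twin s)) F s =
  \sum_(s in drop_twin | P s) push_twin F s.
Proof.
rewrite big_split /= (bigID (fun s : T => s.1 == i')) /= addrC; congr (_ + _).
  apply: eq_bigl => s; rewrite inE /fold_twin; case: (s.1 == i'); rewrite ?andbF ?andbT //.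
rewrite -big_mkcondr /= (reindex_onto (fun s : T => (i', s.2)) (fun s : T => (i, s.2))) /=.
  apply: eq_bigl => -[a j] /=; rewrite /fold_twin /= !inE eqxx xpair_eqE eqxx !andbT /= eq_sym.
  by case: (eqVneq a i) => [->|]; rewrite ?andbF // !andbT twin ii' andbT.
by move=> [a j] /= /andP[_ /eqP->].
Qed.

Lemma fold_twin_in s : s \in S -> fold_twin s \in drop_twin.
Proof.
case: s => a j; rewrite /fold_twin /=; case: eqVneq => [->|ai'] aS; rewrite inE /=.
  by rewrite twin aS ii'.
by rewrite aS.
Qed.

Lemma fold_twin_row s : ((fold_twin s).1 == i) = (s.1 == i) || (s.1 == i').
Proof.
rewrite /fold_twin; case: (eqVneq s.1 i') => [_|_] /=; first by rewrite eqxx orbT.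
by rewrite orbF.
Qed.

Lemma twin_code_eq s : [/\ (twin_code s == 1%N) = (s.1 == i),
  (twin_code s == 2%N) = (s.1 == i') &
  (twin_code s == 0%N) = (s.1 != i) && (s.1 != i')].
Proof.
rewrite /twin_code; case: (eqVneq s.1 i) => [->|_]; last by case: (s.1 == i').
by rewrite (negPf ii').
Qed.

Lemma null_margins_row u (P : pred 'I_m) : null_margins S u ->
  \sum_(s in S | P s.1) u s = 0.
Proof.
move=> [r _]; rewrite (partition_big fst P) /=; last by move=> s /andP[].
apply: big1 => a Pa; rewrite -[RHS](r a); apply: eq_bigl => s.
by case: (eqVneq s.1 a) => [->|]; rewrite ?andbF // Pa !andbT.
Qed.

Lemma null_margins_twin u : null_margins S u <->
  [/\ null_margins drop_twin (push_twin u), \sum_(s in S | s.1 == i) u s = 0 &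
      \sum_(s in S | s.1 == i') u s = 0].
Proof.
have colE j : \sum_(s in drop_twin | s.2 == j) push_twin u s = \sum_(s in S | s.2 == j) u s.
  rewrite -(sum_push_twin (fun s => s.2 == j)); apply: eq_bigl => s.
  by rewrite /fold_twin; case: (s.1 == i').
have rowE k : \sum_(s in drop_twin | s.1 == k) push_twin u s =
    \sum_(s in S | (fold_twin s).1 == k) u s.
  by rewrite (sum_push_twin (fun s => s.1 == k)).
split=> [mu|[[r c] ri ri']].
  split; [split=> k|exact: mu.1|exact: mu.1]; last by rewrite colE mu.2.
  rewrite rowE; rewrite -[RHS](null_margins_row
    (fun a => (if a == i' then i else a) == k) mu).
  by apply: eq_bigl => s; rewrite /fold_twin; case: (s.1 == i').
split=> k; last by rewrite -colE c.
have [->//|ki] := eqVneq k i; have [->//|ki'] := eqVneq k i'.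
rewrite -[RHS](r k) rowE; apply: eq_bigl => s; rewrite /fold_twin.
by case: (eqVneq s.1 i') => [->|//] /=; rewrite eq_sym (negPf ki') eq_sym (negPf ki).
Qed.

Lemma null_twin_code u : null_margins S u -> null_on S twin_code u.
Proof.
move=> mu l; rewrite -[RHS](null_margins_row
  (fun a => (if a == i then 1%N else if a == i' then 2%N else 0%N) == l) mu).
by apply: eq_bigl.
Qed.

(** The old blocks are composed with [fold_twin], then [twin_code] is added with the class function
    telling whether a cell lies in a twin row. Within the twin rows, product weights make the choice
    of the twin independent of the column. *)
Lemma tfp_twin_rows : tfp drop_twin -> tfp S.
Proof.
case=> h [b [g D]]; have [next pref ker wt] := D.
pose b1 q s := if (q <= h)%N then b q (fold_twin s) else twin_code s.
pose g1 r s := if (r < h)%N then g r (fold_twin s)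
  else nat_of_bool ((fold_twin s).1 == i).
have b1E q s : (q <= h)%N -> b1 q s = b q (fold_twin s) by rewrite /b1 => ->.
have nullE (c : T -> nat) u :
    null_on S (fun s => c (fold_twin s)) u <-> null_on drop_twin c (push_twin u).
  by split=> H l; have := H l; rewrite (sum_push_twin (fun s => c s == l)).
have nullb q u : (q <= h)%N ->
    null_on S (b1 q) u <-> null_on drop_twin (b q) (push_twin u).
  by move=> qh; rewrite -nullE /b1 qh.
have codes u : null_on S twin_code u ->
    \sum_(s in S | s.1 == i) u s = 0 /\ \sum_(s in S | s.1 == i') u s = 0.
  move=> H; have := H 1%N; have := H 2%N => H2 H1.
  by split; [rewrite -[RHS]H1|rewrite -[RHS]H2]; apply: eq_bigl => s;
    have [e1 e2 _] := twin_code_eq s; rewrite ?e1 ?e2.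
have nullgh u : null_margins drop_twin (push_twin u) ->
    null_on drop_twin (fun s => nat_of_bool (s.1 == i)) (push_twin u).
  move=> [r _] l; rewrite (partition_big fst (fun a => nat_of_bool (a == i) == l)) /=.
    apply: big1 => a al; rewrite -[RHS](r a); apply: eq_bigl => s.
    by case: (eqVneq s.1 a) => [->|]; rewrite ?andbF // al !andbT.
  by move=> s /andP[].
exists h.+1, b1, g1; split.
- move=> r u; rewrite ltnS leq_eqVlt => /orP[/eqP->|rh]; last first.
    move/nullb => /(_ rh) /(next _ _ rh); rewrite -nullE.
    by rewrite /g1 rh.
  rewrite /b1 ltnn => H; rewrite /g1 ltnn => l.
  have [s1 s2] := codes u H; have s0 := H 0%N.
  case: l => [|[|l]].
  + rewrite -[RHS]s0; apply: eq_bigl => s; have [_ _ ->] := twin_code_eq s.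
    by rewrite fold_twin_row eqb0 negb_or.
  + rewrite (eq_bigl (fun s : T => (s \in S) && ((s.1 == i) || (s.1 == i')))); last first.
      by move=> s; rewrite fold_twin_row eqb1.
    transitivity (\sum_(s in S | s.1 == i) u s + \sum_(s in S | s.1 == i') u s);
      last by rewrite s1 s2 addr0.
    rewrite (bigID (fun s : T => s.1 == i)) /=.
    congr (_ + _); apply: eq_bigl => s; case: (s \in S) => //=.
      by case: (s.1 == i); rewrite ?andbF ?andbT.
    by case: (eqVneq s.1 i) => [->|]; rewrite ?andbF ?andbT //= (negPf ii').
  + by rewrite big_pred0 // => s; case: (_ == i); rewrite andbF.
- move=> r u; rewrite ltnS leq_eqVlt => /orP[/eqP->|rh] H; last first.
    rewrite /g1 rh nullE; apply: pref => // q qr; apply/nullb; last exact: H.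
    exact: leq_trans qr (ltnW rh).
  rewrite /g1 ltnn (nullE (fun s => nat_of_bool (s.1 == i))).
  by apply: nullgh; apply/ker => q qh; apply/nullb => //; exact: H.
- move=> u; split=> [H|mu q].
    have mu : null_margins drop_twin (push_twin u).
      by apply/ker => q qh; apply/nullb => //; apply: H; exact: leqW.
    have := H h.+1 (leqnn _); rewrite /b1 ltnn => /codes[s1 s2].
    exact/null_margins_twin.
  rewrite leq_eqVlt => /orP[/eqP->|qh]; last first.
    by apply/nullb => //; move: q qh; apply/ker; case/null_margins_twin: mu.
  by rewrite /b1 ltnn; exact: null_twin_code.
move=> r x y s s'.
(* Merging the twins preserves product weights, row [i] receiving the sum of the two row weights. *)
have pushw P : weight S x y (fun t => P (fold_twin t)) =
    weight drop_twin (fun a => x a + (if a == i then x i' else 0))%N y P.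
  rewrite /weight [LHS](sum_push_twin (V := nat)); apply: eq_bigr => t _.
  rewrite /push_twin /= mulnDl; congr (_ + _)%N.
  by case: (t.1 == i); rewrite ?mul0n.
have wE (P Q : pred T) : {in S, P =1 Q} -> weight S x y P = weight S x y Q.
  by move=> PQ; apply: eq_bigl => t; case tS: (t \in S) => //=; rewrite PQ.
rewrite ltnS leq_eqVlt => /orP[/eqP->|rh] sS s'S; last first.
  rewrite /g1 rh => gss'.
  have preE t : same_prefix b1 r s t = same_prefix b r (fold_twin s) (fold_twin t).
    apply: eq_forallb => q; have qh : (q <= h)%N by rewrite (leq_trans _ (ltnW rh)) // -ltnS.
    by rewrite !b1E.
  have := wt r (fun a => x a + (if a == i then x i' else 0))%N y _ _ rh
    (fold_twin_in sS) (fold_twin_in s'S) gss'.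
  rewrite -!pushw => E; etransitivity; [|etransitivity; [exact: E|]];
    by congr (_ * _)%N; apply: wE => t _; rewrite /= ?preE ?b1E.
rewrite /g1 ltnn => gss'.
have codeE t : (b1 h.+1 t == b1 h.+1 s') = (twin_code t == twin_code s') by rewrite /b1 ltnn.
have {}gss' : ((fold_twin s).1 == i) = ((fold_twin s').1 == i).
  by move: gss'; do 2![case: (_ == i)].
(* By [tfp_inj], the full prefix determines the folded cell. *)
have preE t : t \in S -> same_prefix b1 h s t = (fold_twin t == fold_twin s).
  move=> tS; apply/same_prefixP/eqP => [H|e q qh]; last by rewrite !b1E // e.
  apply: (tfp_inj D) (fold_twin_in sS) (fold_twin_in tS) _ => q qh.
  by rewrite -!b1E // H.
have gE : weight S x y (fun t => nat_of_bool ((fold_twin t).1 == i) ==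
    nat_of_bool ((fold_twin s).1 == i)) =
    weight S x y (fun t => ((fold_twin t).1 == i) == ((fold_twin s).1 == i)).
  by apply: wE => t _; do 2![case: (_ == i)].
rewrite {}gE.
(* Away from the twin rows the class is the set of cells with extra label 0, so both sides have the
   same factors. *)
have [si|si] := boolP ((fold_twin s).1 == i); last first.
  have code0 : twin_code s' = 0%N.
    have [_ _ e0] := twin_code_eq s'; apply/eqP; rewrite e0 -negb_or -fold_twin_row.
    by rewrite -gss'.
  rewrite [X in (_ * X)%N = _](wE _ (fun t => b1 h.+1 t == b1 h.+1 s')); last first.
    move=> t tS /=; rewrite codeE code0; have [_ _ ->] := twin_code_eq t.
    by rewrite -negb_or -fold_twin_row; case: (_ == i).
  congr (_ * _)%N; apply: wE => t tS; rewrite preE // codeE code0 andb_idr // => /eqP ts.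
  have [_ _ ->] := twin_code_eq t.
  by rewrite -negb_or -fold_twin_row ts.
have rowY (F : 'I_n -> nat) k : (k == i) || (k == i') ->
    (\sum_(t in S | t.1 == k) F t.2 = \sum_(j | (i, j) \in S) F j)%N.
  move=> ki; rewrite (reindex_onto (fun j => (k, j)) snd) /=.
    apply: eq_bigl => j; rewrite !eqxx !andbT.
    by case/orP: ki => /eqP-> //; rewrite twin.
  by case=> c l /= /andP[_ /eqP->].
have si' : (s'.1 == i) || (s'.1 == i') by rewrite -fold_twin_row -gss'.
have codek t : (twin_code t == twin_code s') = (t.1 == s'.1).
  rewrite /twin_code; case/orP: si' => /eqP->; rewrite eqxx.
    by case: (t.1 == i) => //; case: (t.1 == i').
  rewrite [i' == i]eq_sym (negPf ii'); case: (eqVneq t.1 i) => [->|_]; first by rewrite (negPf ii').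
  by case: (t.1 == i').
have cell_k : (s'.1, s.2) \in S.
  have : (i, s.2) \in S.
    have := sS; rewrite [s in s \in S]surjective_pairing.
    by move: si; rewrite fold_twin_row => /orP[] /eqP->; rewrite ?twin.
  by case/orP: si' => /eqP->; rewrite ?twin.
have fs : fold_twin s = (i, s.2).
  by move: si; rewrite /fold_twin; case: (s.1 == i') => //= /eqP<-; rewrite -surjective_pairing.
(* With k the row of [s'] and j the column of [s], both sides come out as x_k y_j (x_i + x_i') Y. *)
pose Y := (\sum_(j | (i, j) \in S) y j)%N.
have -> : weight S x y (fun t => same_prefix b1 h s t && (b1 h.+1 t == b1 h.+1 s')) =
    (x s'.1 * y s.2)%N.
  rewrite (wE _ (pred1 (s'.1, s.2))).
    rewrite /weight (eq_bigl (pred1 (s'.1, s.2))) ?big_pred1_eq // => t /=.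
    by case: eqP => [->|]; rewrite ?andbF ?andbT // cell_k.
  move=> [c l] tS /=; rewrite preE // codeE codek fs /fold_twin /= xpair_eqE andbC.
  case: (eqVneq c s'.1) => //= ->.
  by case/orP: si' => /eqP->; rewrite ?eqxx ?(negPf ii') /= ?xpair_eqE ?eqxx.
have -> : weight S x y (fun t => ((fold_twin t).1 == i) == true) =
    ((x i + x i') * Y)%N.
  rewrite (wE _ (fun t => (fold_twin t).1 == i)); last by move=> t _; case: (_ == i).
  rewrite (pushw (fun t => t.1 == i)) /weight.
  rewrite (eq_bigr (fun t : T => (x i + x i') * y t.2)%N); last first.
    by move=> t /andP[_ /eqP->]; rewrite eqxx.
  rewrite -big_distrr /= /Y -(rowY y i) ?eqxx //; congr (_ * _)%N; apply: eq_bigl => t.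
  by rewrite inE; case: (eqVneq t.1 i) => [->|]; rewrite ?andbF // ii' andbT.
have -> : weight S x y (same_prefix b1 h s) = ((x i + x i') * y s.2)%N.
  rewrite (wE _ (fun t => fold_twin t == (i, s.2))); last by move=> t tS; rewrite preE // fs.
  rewrite (pushw (pred1 (i, s.2))) /weight (eq_bigl (pred1 (i, s.2))).
    by rewrite big_pred1_eq /= eqxx.
  move=> t /=; case: eqP => [->|]; rewrite ?andbF // andbT inE /= ii' andbT.
  by have := fold_twin_in sS; rewrite fs inE => /andP[].
have -> : weight S x y (fun t => b1 h.+1 t == b1 h.+1 s') = (x s'.1 * Y)%N.
  rewrite (wE _ (fun t => t.1 == s'.1)); last by move=> t _; rewrite codeE codek.
  rewrite /weight (eq_bigr (fun t : T => x s'.1 * y t.2)%N); last by move=> t /andP[_ /eqP->].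
  by rewrite -big_distrr /= rowY.
by rewrite mulnACA [RHS]mulnACA [in RHS](mulnC _ (x s'.1)).
Qed.

End TwinRows.

(** * Transposition, and induction on the number of cells *)

Definition swap (A B : Type) (s : A * B) : B * A := (s.2, s.1).

Lemma swapK (A B : Type) : cancel (@swap A B) (@swap B A).
Proof. by case. Qed.

Definition transpose m n (S : {set 'I_m * 'I_n}) : {set 'I_n * 'I_m} :=
  [set s | swap s \in S].

Lemma sum_transpose m n (S : {set 'I_m * 'I_n}) (V : nmodType)
    (P : pred ('I_n * 'I_m)) (F : 'I_m * 'I_n -> V) :
  \sum_(s in S | P (swap s)) F s = \sum_(s in transpose S | P s) F (swap s).
Proof.
rewrite (reindex_onto (@swap _ _) (@swap _ _)) /=; last by move=> s _; exact: swapK.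
by apply: eq_bigl => s; rewrite !swapK eqxx andbT inE.
Qed.

Lemma tfp_transpose m n (S : {set 'I_m * 'I_n}) : tfp (transpose S) -> tfp S.
Proof.
case=> h [b [g [next pref ker wt]]].
have nullE (c : 'I_n * 'I_m -> nat) u :
    null_on S (fun s => c (swap s)) u <-> null_on (transpose S) c (fun s => u (swap s)).
  by split=> H l; have := H l; rewrite (sum_transpose S (fun s => c s == l)).
have weightE x y (P : pred ('I_n * 'I_m)) :
    weight S x y (fun t => P (swap t)) = weight (transpose S) y x P.
  rewrite /weight (sum_transpose S (V := nat)); apply: eq_bigr => t _.
  by rewrite mulnC.
exists h, (fun q s => b q (swap s)), (fun q s => g q (swap s)); split.
- by move=> r u rh; rewrite !nullE; apply: next.
- by move=> r u rh H; rewrite nullE; apply: pref => // q /H; rewrite nullE.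
- move=> u; have -> : null_margins S u <-> null_margins (transpose S) (fun s => u (swap s)).
    split=> -[r c]; split=> k.
    + by rewrite -(sum_transpose S (fun s => s.1 == k)) c.
    + by rewrite -(sum_transpose S (fun s => s.2 == k)) r.
    + by rewrite (sum_transpose S (fun s => s.2 == k)) c.
    + by rewrite (sum_transpose S (fun s => s.1 == k)) r.
  rewrite -ker; split=> H q qh; [by rewrite -nullE; apply: H|by rewrite nullE; apply: H].
move=> r x y s s' rh sS s'S gss'.
have := wt r y x (swap s) (swap s') rh; rewrite !inE !swapK => /(_ sS s'S gss').
by rewrite -!weightE.
Qed.

(** Induction on the number of cells. The only cell of a row or column is free, because its value is
    a margin; one of two twin rows is dropped; twin columns are handled by transposing. The smaller
    set is always a restriction to some rows and columns, so it inherits exchange. *)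
Lemma exchange_tfp m n (S : {set 'I_m * 'I_n}) : exchange (row_cols S) -> tfp S.
Proof.
move: {2}#|S|.+1 (ltnSn #|S|) => k; elim: k S => // k IH S Sk exS.
have [->|[s0 s0S]] := set_0Vmem S; first exact: tfp0.
have N0 : row_cols S s0.1 != set0.
  by apply/set0Pn; exists s0.2; rewrite inE -surjective_pairing.
have restrict (S' : {set 'I_m * 'I_n}) (P : pred 'I_m) (D : {set 'I_n}) c :
    (forall s, (s \in S') = [&& s \in S, P s.1 & s.2 \in D]) ->
    c \in S -> c \notin S' -> tfp S'.
  move=> S'E cS cS'; apply: IH.
    rewrite -ltnS; apply: leq_trans Sk; rewrite ltnS; apply: proper_card.
    apply/properP; split; last by exists c.
    by apply/subsetP=> s; rewrite S'E => /andP[].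
  have N'E i : row_cols S' i = if P i then row_cols S i :&: D else set0.
    by apply/setP=> j; rewrite inE S'E /=; case: (P i); rewrite !inE ?andbF.
  exact: exchange_restrict N'E exS.
have point c (P : pred 'I_m) (D : {set 'I_n}) : c \in S ->
    (forall s, (s \in S :\ c) = [&& s \in S, P s.1 & s.2 \in D]) ->
    (forall u, null_margins S u -> u c = 0) -> tfp S.
  move=> cS S'E uc; rewrite -(setD1K cS); apply: tfp_add_point; rewrite ?setD11 //.
    by rewrite setD1K.
  by apply: (restrict _ P D c) => //; rewrite setD11.
case: (elimination exS N0) => [[i [j Nij]]|[i [j Nij]]|[i [i' [ii' NN Ni]]]|[j [j' [i [jj' jN NN]]]]].
- have rowi l : ((i, l) \in S) = (l == j).
    by have /setP/(_ l) := Nij; rewrite !inE.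
  apply: (point (i, j) (fun a => a != i) setT); first by rewrite rowi.
    move=> [a l]; rewrite !inE andbT xpair_eqE andbC; case: (eqVneq a i) => [->|] //=.
    by rewrite rowi; case: (l == j).
  move=> u [r _]; have := r i; rewrite (big_pred1 (i, j)) // => -[a l] /=.
  by rewrite xpair_eqE andbC; case: (eqVneq a i) => [->|] //=; rewrite rowi.
- have colj a : ((a, j) \in S) = (a == i) by rewrite -Nij inE.
  apply: (point (i, j) xpredT [set~ j]); first by rewrite colj.
    move=> [a l]; rewrite !inE /= xpair_eqE andbC [in LHS]andbC; case: (eqVneq l j) => [->|] //=.
      by rewrite colj; case: (a == i).
    by rewrite andbF andbT.
  move=> u [_ c]; have := c j; rewrite (big_pred1 (i, j)) // => -[a l] /=.
  by rewrite xpair_eqE; case: (eqVneq l j) => [->|]; rewrite ?andbF // colj andbT.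
- have twin l : ((i, l) \in S) = ((i', l) \in S).
    by have /setP/(_ l) := NN; rewrite !inE.
  case/set0Pn: Ni => l; rewrite inE => il.
  apply: (tfp_twin_rows ii' twin).
  apply: (restrict _ (fun a => a != i') setT (i', l)); rewrite ?inE -?twin ?il ?eqxx //=.
  by move=> s; rewrite !inE andbT.
- have twin a : ((j, a) \in transpose S) = ((j', a) \in transpose S).
    by have := NN a; rewrite !inE.
  apply: tfp_transpose; apply: (tfp_twin_rows jj' twin).
  apply: tfp_transpose.
  apply: (restrict _ xpredT [set~ j'] (i, j')).
  + by move=> [a l]; rewrite !inE.
  + by have := NN i; rewrite !inE => <-; rewrite inE in jN.
  + by rewrite !inE /= eqxx andbF.
Qed.
(** * From labelings to matrices and toric ideals *)

Section Ideals.
Variables (C : fieldType) (N : nat) (G : {mpoly C[N]} -> Prop).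

Lemma gen_ideal0 : gen_ideal G 0.
Proof. by exists [::]; split=> //; rewrite big_nil. Qed.

Lemma gen_idealD f1 f2 : gen_ideal G f1 -> gen_ideal G f2 -> gen_ideal G (f1 + f2).
Proof.
move=> [l1 [l1G ->]] [l2 [l2G ->]]; exists (l1 ++ l2); split; last by rewrite big_cat.
by move=> q; rewrite mem_cat => /orP[/l1G|/l2G].
Qed.

Lemma gen_ideal_mul q f : G f -> gen_ideal G (q * f).
Proof.
by move=> Gf; exists [:: (q, f)]; split=> [q'|]; rewrite ?big_seq1 // inE => /eqP->.
Qed.

Lemma gen_ideal_sum I (r : seq I) (F : I -> {mpoly C[N]}) :
  (forall i, gen_ideal G (F i)) -> gen_ideal G (\sum_(i <- r) F i).
Proof.
move=> GF; elim: r => [|i r IH]; first by rewrite big_nil; exact: gen_ideal0.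
by rewrite big_cons; apply: gen_idealD.
Qed.

End Ideals.

(** * Multigraded toric ideals *)

Section Homogeneous.
Variables (C : fieldType) (N c : nat) (g : 'I_N -> 'I_c).

Lemma mcoeff_multigraded_part a (f : {mpoly C[N]}) u :
  (multigraded_part g a f)@_u = if multidegree g u == a then f@_u else 0.
Proof.
rewrite /multigraded_part raddf_sum /=.
under eq_bigr do rewrite mcoeffZ mcoeffX.
have [uf|uf] := boolP (u \in msupp f); last first.
  rewrite memN_msupp_eq0 // if_same big1_seq // => w /andP[_ wf].
  by case: (eqVneq w u) => [wu|_]; [rewrite wu (negPf uf) in wf|rewrite mulr0].
rewrite big_mkcond (bigD1_seq u) ?msupp_uniq //= eqxx mulr1 big1 ?addr0 // => w /negPf->.
by rewrite mulr0 if_same.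
Qed.

Lemma multigraded_partD a (f1 f2 : {mpoly C[N]}) :
  multigraded_part g a (f1 + f2) = multigraded_part g a f1 + multigraded_part g a f2.
Proof.
apply/mpolyP=> u; rewrite mcoeffD !mcoeff_multigraded_part mcoeffD.
by case: ifP; rewrite ?addr0.
Qed.

Lemma multigraded_part0 a : multigraded_part g a (0 : {mpoly C[N]}) = 0.
Proof. by apply/mpolyP=> u; rewrite mcoeff_multigraded_part mcoeff0 if_same. Qed.

Lemma multigraded_part_sum a I (r : seq I) (F : I -> {mpoly C[N]}) :
  multigraded_part g a (\sum_(i <- r) F i) = \sum_(i <- r) multigraded_part g a (F i).
Proof.
by apply: (big_morph (multigraded_part g a)); [exact: multigraded_partD|exact: multigraded_part0].
Qed.

Lemma multidegreeD u v :
  multidegree g (u + v)%MM = [ffun a => (multidegree g u a + multidegree g v a)%N].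
Proof.
by apply/ffunP=> a; rewrite !ffunE -big_split /=; apply: eq_bigr => s _; rewrite mnmDE.
Qed.

Lemma multigraded_part_binomial a (k : C) w u v : multidegree g u = multidegree g v ->
  multigraded_part g a (k *: 'X_[w] * ('X_[u] - 'X_[v])) =
  if multidegree g (w + u)%MM == a then k *: 'X_[w] * ('X_[u] - 'X_[v]) else 0.
Proof.
move=> uv.
have vE : multidegree g (w + v)%MM = multidegree g (w + u)%MM by rewrite !multidegreeD uv.
rewrite -scalerAl mulrBr -!mpolyXD.
apply/mpolyP=> x; rewrite mcoeff_multigraded_part.
case: (eqVneq (multidegree g x) a) => [xa|xa].
  case: ifPn => // wa; rewrite mcoeffZ mcoeffB !mcoeffX mcoeff0.
  case: (eqVneq (w + u)%MM x) => [E|_]; first by rewrite E xa eqxx in wa.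
  case: (eqVneq (w + v)%MM x) => [E|_]; last by rewrite subrr mulr0.
  by rewrite -vE E xa eqxx in wa.
case: ifPn => [/eqP wa|_]; last by rewrite mcoeff0.
rewrite mcoeffZ mcoeffB !mcoeffX.
case: (eqVneq (w + u)%MM x) => [E|_]; first by rewrite -wa E eqxx in xa.
case: (eqVneq (w + v)%MM x) => [E|_]; last by rewrite subrr mulr0.
by rewrite -wa -vE E eqxx in xa.
Qed.

(** Class sums vanish on the kernel, so the two monomials of a generator have the same multidegree,
    and each monomial multiple of a generator is kept or killed as a whole by [multigraded_part]. *)
Lemma toric_homogeneous d (X : 'M[int]_(d, N)) :
  (forall w : 'I_N -> int, (forall i, \sum_s X i s * w s = 0) ->
     forall a, \sum_(s | g s == a) w s = 0) ->
  homogeneous_ideal g (toric_ideal C X).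
Proof.
move=> gX f a [l [lG ->]]; rewrite multigraded_part_sum.
have {lG} : forall q, q \in l -> toric_ideal C X (multigraded_part g a (q.1 * q.2)).
  move=> q /lG[u [v [ker qE]]]; have -> : q.2 = 'X_[u] - 'X_[v] by [].
  have uv : multidegree g u = multidegree g v.
    apply/ffunP=> b; rewrite !ffunE; apply: sum_Posz_eq.
    by apply: gX => i; exact: ker.
  rewrite [q.1]mpolyE mulr_suml multigraded_part_sum; apply: gen_ideal_sum => w.
  rewrite multigraded_part_binomial //; case: ifP => _; last exact: gen_ideal0.
  by apply: gen_ideal_mul; exists u, v.
elim: l => [|q l IH] H; first by rewrite big_nil; exact: gen_ideal0.
rewrite big_cons; apply: gen_idealD; first by apply: H; rewrite inE eqxx.
by apply: IH => q' q'l; apply: H; rewrite inE q'l orbT.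
Qed.

End Homogeneous.

(** * Multisets of columns *)

Section Multiset.
Variable N : nat.

Definition expand (e : 'I_N -> nat) : seq 'I_N :=
  flatten [seq nseq (e s) s | s <- enum 'I_N].

Lemma sum_expand (V : nmodType) e (P : pred 'I_N) (F : 'I_N -> V) :
  \sum_(s <- expand e | P s) F s = \sum_(s | P s) F s *+ e s.
Proof.
rewrite /expand big_flatten big_map big_enum /= [RHS]big_mkcond; apply: eq_bigr => s _.
by rewrite big_nseq_cond; case: ifP => // _; rewrite iter_addr addr0.
Qed.

Definition expand_cols d (A : 'M[int]_(d, N)) e : 'M[int]_(d, size (expand e)) :=
  colsub (tnth (in_tuple (expand e))) A.

Lemma col_expand d (A : 'M[int]_(d, N)) e a :
  col a (expand_cols A e) = col (tnth (in_tuple (expand e)) a) A.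
Proof. by apply/colP=> i; rewrite !mxE. Qed.

Lemma expand_kernel d (A : 'M[int]_(d, N)) e (w : 'I_(size (expand e)) -> int) i :
  \sum_a expand_cols A e i a * w a =
  \sum_s A i s * \sum_(a | tnth (in_tuple (expand e)) a == s) w a.
Proof.
rewrite (partition_big (tnth (in_tuple (expand e))) xpredT) //=.
apply: eq_bigr => s _; rewrite mulr_sumr; apply: eq_bigr => a /eqP sa.
by rewrite !mxE sa.
Qed.

Lemma count_columns d M (A : 'M[int]_(d, M)) v :
  count_mem v (columns A) = (\sum_(s | col s A == v) 1)%N.
Proof. by rewrite /columns count_map -sum1_count big_enum_cond. Qed.

Lemma count_expand_cols d (A : 'M[int]_(d, N)) e v :
  count_mem v (columns (expand_cols A e)) = (\sum_(s | col s A == v) e s)%N.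
Proof.
rewrite count_columns (eq_bigl _ _ (fun a => congr1 (eq_op^~ v) (col_expand A (e := e) a))).
rewrite -(big_tnth _ _ _ (fun s => col s A == v) (fun=> 1%N)) (sum_expand (V := nat)).
by apply: eq_bigr => s _; exact: natn.
Qed.

Variables (K : eqType) (key : 'I_N -> K).

(* All the multiplicity of a fiber of key is put on one representative. *)
Definition spread (a : 'I_N -> nat) (s : 'I_N) : nat :=
  if [pick t | key t == key s] == Some s then a s else 0%N.

Lemma sum_spread a s : (forall t, key t = key s -> a t = a s) ->
  (\sum_(t | key t == key s) spread a t)%N = a s.
Proof.
move=> aE; case E: [pick t | key t == key s] => [t0|]; last first.
  by move: E; case: pickP => // /(_ s); rewrite eqxx.
have t0s : key t0 = key s by move: E; case: pickP => // t /eqP ts [<-].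
(* The result of [pick] depends only on the fiber, so all its members choose the same
   representative. *)
have pickE t : key t = key s -> [pick t' | key t' == key t] = Some t0.
  by move=> ts; rewrite -E; apply: eq_pick => t'; rewrite /= ts.
rewrite (bigD1 t0) ?t0s ?eqxx //= big1 => [|t /andP[/eqP ts tt0]].
  by rewrite addn0 /spread pickE // eqxx aE.
by rewrite /spread pickE //; case: eqP => // -[tt]; rewrite tt eqxx in tt0.
Qed.

End Multiset.
Lemma biggcd_mulr (I : finType) (P : pred I) (F : I -> nat) k :
  (\big[gcdn/0]_(t | P t) F t * k = \big[gcdn/0]_(t | P t) (F t * k))%N.
Proof.
apply: (big_morph (fun x => x * k)%N) => [x y|]; last exact: mul0n.
by rewrite muln_gcdl.
Qed.

(** If equal columns had different classes, the difference of their indicators would be a kernel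
    vector with a class sum equal to 1. *)
Lemma graded_fibers d N c (A : 'M[int]_(d, N)) (g : 'I_N -> 'I_c) :
  (forall w : 'I_N -> int, (forall i, \sum_s A i s * w s = 0) ->
     forall a, \sum_(s | g s == a) w s = 0) ->
  forall s t, col s A = col t A -> g s = g t.
Proof.
move=> gA s t st; apply/eqP; apply: contraT => gst.
pose w (k : 'I_N) : int := (k == s)%:R - (k == t)%:R.
have delta (F : 'I_N -> int) k0 : \sum_k F k * (k == k0)%:R = F k0.
  rewrite (bigD1 k0) //= eqxx mulr1 big1 ?addr0 // => k /negPf->.
  by rewrite mulr0.
have := gA w; rewrite /w => /(_ _ (g s)) H.
have : \sum_(k | g k == g s) ((k == s)%:R - (k == t)%:R : int) = 0.
  apply: H => i; under eq_bigr do rewrite mulrBr; rewrite sumrB !delta.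
  by have /colP/(_ i) := st; rewrite !mxE => ->; rewrite subrr.
rewrite big_mkcond /= (eq_bigr (fun k => (g k == g s)%:R * (k == s)%:R
    - (g k == g s)%:R * (k == t)%:R)); last first.
  by move=> k _; rewrite -mulrBr; case: ifP; rewrite ?mul1r ?mul0r.
by rewrite sumrB !delta eqxx eq_sym (negPf gst).
Qed.

Lemma expand_graded d N c (A : 'M[int]_(d, N)) (g : 'I_N -> 'I_c) e :
  (forall w : 'I_N -> int, (forall i, \sum_s A i s * w s = 0) ->
     forall a, \sum_(s | g s == a) w s = 0) ->
  forall w : 'I_(size (expand e)) -> int,
    (forall i, \sum_a expand_cols A e i a * w a = 0) ->
    forall a, \sum_(k | g (tnth (in_tuple (expand e)) k) == a) w k = 0.
Proof.
move=> gA w wA a.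
pose w' s := \sum_(k | tnth (in_tuple (expand e)) k == s) w k.
rewrite (partition_big (tnth (in_tuple (expand e))) (fun s => g s == a)) //=.
rewrite -[RHS](gA w' _ a) => [|i]; last by rewrite -expand_kernel.
apply: eq_bigr => s gs; apply: eq_bigl => k.
by case: (eqVneq (tnth _ k) s) => [->|]; rewrite ?andbF // gs.
Qed.

(** * Integral factorization of column multiplicities *)

Section FiberProduct.
Variables (C : fieldType) (d d' N c : nat).
Variables (A : 'M[int]_(d, N)) (B : 'M[int]_(d', N)) (g : 'I_N -> 'I_c).
Hypothesis gA : forall w : 'I_N -> int, (forall i, \sum_s A i s * w s = 0) ->
  forall a, \sum_(s | g s == a) w s = 0.
Hypothesis gB : forall w : 'I_N -> int, (forall i, \sum_s B i s * w s = 0) ->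
  forall a, \sum_(s | g s == a) w s = 0.

Definition mult (P : pred 'I_N) : nat := \sum_(t | P t) 1.

Hypothesis multE : forall s s', g s = g s' ->
  (mult (fun t => (col t A == col s A) && (col t B == col s' B)) *
     mult (fun t => g t == g s) =
   mult (fun t => col t A == col s A) * mult (fun t => col t B == col s' B))%N.

(* In each class the multiplicities of the columns of col_mx A B form a matrix of
   rank 1; dividing by the gcd G of the row sums factors it over the integers. *)
Let mA s := mult (fun t => col t A == col s A).
Let mB s := mult (fun t => col t B == col s B).
Let mg s := mult (fun t => g t == g s).
Let G s := \big[gcdn/0%N]_(t | g t == g s) mA t.
Let a s := (mA s %/ G s)%N.
Let b s := (G s * mB s %/ mg s)%N.

Let mult_gt0 (P : pred 'I_N) s : P s -> (0 < mult P)%N.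
Proof. by move=> Ps; rewrite /mult (bigD1 s). Qed.

Let mult_le (P Q : pred 'I_N) : (forall t, P t -> Q t) -> (mult P <= mult Q)%N.
Proof.
move=> PQ; rewrite /mult [X in (_ <= X)%N](bigID P) /= -[X in (X <= _)%N]addn0.
rewrite leq_add // leq_eqVlt; apply/orP; left; apply/eqP; apply: eq_bigl => t.
by case Pt: (P t); rewrite ?andbF // PQ.
Qed.

Let G_dvd s t : g t = g s -> (G s %| mA t)%N.
Proof.
move=> gt; have := dvdnn (G s); rewrite {2}/G => /dvdn_biggcdP; apply.
exact/eqP.
Qed.

(** By [multE] the class size divides every product [mA t * mB s] with [t] in the class, hence the
    gcd of these products. *)
Let mg_dvd s : (mg s %| G s * mB s)%N.
Proof.
rewrite biggcd_mulr; apply/dvdn_biggcdP => t /eqP gt.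
rewrite /mA -(multE gt); apply/dvdnP.
by exists (mult (fun k => (col k A == col t A) && (col k B == col s B))); rewrite /mg gt.
Qed.

Let ab s s' : g s = g s' ->
  (a s * b s' = mult (fun t => (col t A == col s A) && (col t B == col s' B)))%N.
Proof.
move=> gs; have mg0 : (0 < mg s)%N by apply: (mult_gt0 (s := s)) => /=.
have GE : G s = G s' by rewrite /G gs.
have mgE : mg s = mg s' by rewrite /mg gs.
apply/eqP; rewrite -(eqn_pmul2r mg0) (multE gs) -/(mA s) -/(mB s').
rewrite -mulnA mgE /b divnK ?mg_dvd // -GE mulnA /a divnK //.
exact: G_dvd.
Qed.

Let a_le s : (a s <= mA s)%N.
Proof. exact: leq_div. Qed.

Let b_le s : (b s <= mB s)%N.
Proof.
have mg0 : (0 < mg s)%N by apply: (mult_gt0 (s := s)) => /=.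
rewrite /b -(leq_pmul2r mg0) divnK ?mg_dvd // mulnC leq_mul2l; apply/orP; right.
(* [G s] divides [mA s], which is at most the class size because equal columns share a class. *)
have mA0 : (0 < mA s)%N by apply: (mult_gt0 (s := s)) => /=.
apply: leq_trans (dvdn_leq mA0 (G_dvd (erefl _))) _.
by apply: mult_le => t /eqP /(graded_fibers gA) ->.
Qed.

Let a_const s t : col t A = col s A -> a t = a s.
Proof. by move=> E; rewrite /a /G /mA E (graded_fibers gA E). Qed.

Let b_const s t : col t B = col s B -> b t = b s.
Proof. by move=> E; rewrite /b /G /mg /mB E (graded_fibers gB E). Qed.

Let eX := spread (fun s => col s A) a.
Let eY := spread (fun s => col s B) b.

(** The column of [s] is repeated [a s] times in [X] and [b s] times in [Y]; by [ab], pairs within a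
    class then have the multiplicities of [col_mx A B]. Pairs from different classes occur on
    neither side. *)
Lemma fiber_product_exists : exists (M M' : nat) (X : 'M[int]_(d, M))
    (Y : 'M[int]_(d', M')) (gX : 'I_M -> 'I_c) (gY : 'I_M' -> 'I_c),
  [/\ sub_columns X A, sub_columns Y B & toric_fiber_product C X gX Y gY (col_mx A B)].
Proof.
exists (size (expand eX)), (size (expand eY)), (expand_cols A eX), (expand_cols B eY).
exists (fun k => g (tnth (in_tuple (expand eX)) k)).
exists (fun k => g (tnth (in_tuple (expand eY)) k)).
split=> [v|v|].
- rewrite count_expand_cols count_columns.
  have [s /eqP <-|noS] := pickP (fun s => col s A == v); last by rewrite !big_pred0.
  by rewrite sum_spread; [exact: a_le|move=> t; exact: a_const].
- rewrite count_expand_cols count_columns.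
  have [s /eqP <-|noS] := pickP (fun s => col s B == v); last by rewrite !big_pred0.
  by rewrite sum_spread; [exact: b_le|move=> t; exact: b_const].
split.
- apply: toric_homogeneous => w wX; exact: expand_graded gA _ wX.
- apply: toric_homogeneous => w wY; exact: expand_graded gB _ wY.
apply/allP => v _ /=; apply/eqP.
rewrite count_columns -[v]vsubmxK; set v1 := usubmx v; set v2 := dsubmx v.
have col_eq u1 u2 : (col_mx u1 u2 == col_mx v1 v2) = (u1 == v1) && (u2 == v2).
  by apply/eqP/andP => [/eq_col_mx[-> ->]|[/eqP-> /eqP->]].
have -> : (\sum_(s | col s (col_mx A B) == col_mx v1 v2) 1 =
    \sum_(s | (col s A == v1) && (col s B == v2)) 1)%N.
  by apply: eq_bigl => s; rewrite -col_eq; congr (_ == _); apply/colP => i; rewrite !mxE; case: split => k; rewrite mxE.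
rewrite count_map count_filter -sum1_count big_enum_cond /=.
transitivity (\sum_(s | col s A == v1) \sum_(s' | (col s' B == v2) && (g s == g s'))
    eX s * eY s')%N; last first.
  pose LX := in_tuple (expand eX); pose LY := in_tuple (expand eY).
  transitivity (\sum_(i | col (tnth LX i) A == v1)
      \sum_(j | (col (tnth LY j) B == v2) && (g (tnth LX i) == g (tnth LY j))) 1)%N.
    rewrite -(big_tnth _ _ _ (fun s => col s A == v1) (fun s =>
      \sum_(j | (col (tnth LY j) B == v2) && (g s == g (tnth LY j))) 1)%N).
    rewrite (sum_expand (V := nat)); apply: eq_bigr => s _.
    rewrite -(big_tnth _ _ _ (fun s' => (col s' B == v2) && (g s == g s')) (fun=> 1%N)).
    rewrite (sum_expand (V := nat)) -mulr_natl natn -big_distrr /=; congr (_ * _)%N.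
    by apply: eq_bigr => s' _; rewrite natn.
  rewrite pair_big_dep /=; apply: eq_bigl => -[i j] /=.
  by rewrite !col_expand col_eq andbA andbC.
have [s1 /eqP s1E|noS] := pickP (fun s => col s A == v1); last first.
  by rewrite !big_pred0 // => s; rewrite noS.
have [s2 /eqP s2E|noS] := pickP (fun s => col s B == v2); last first.
  rewrite big_pred0; last by move=> s; rewrite noS andbF.
  by rewrite big1 // => s _; rewrite big_pred0 // => s'; rewrite noS.
have [gs|gs] := eqVneq (g s1) (g s2).
  rewrite -s1E -s2E -/(mult _) -(ab gs).
  rewrite -(sum_spread (key := fun s => col s A) (a := a) (s := s1)); last exact: a_const.
  rewrite big_distrl /=; apply: eq_bigr => s /eqP sE.
  rewrite -(sum_spread (key := fun s => col s B) (a := b) (s := s2)); last exact: b_const.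
  rewrite big_distrr /=; apply: eq_bigl => s'; case: eqP => //= s'E.
  by rewrite (graded_fibers gA sE) (graded_fibers gB s'E) gs eqxx.
rewrite big_pred0; last first.
  move=> s; apply/negP => /andP[/eqP e1 /eqP e2]; case/eqP: gs.
  by rewrite -(graded_fibers gA (etrans e1 (esym s1E))) (graded_fibers gB (etrans e2 (esym s2E))).
rewrite big1 // => s /eqP e1; rewrite big_pred0 // => s'; apply/negP => /andP[/eqP e2 /eqP ee].
case/eqP: gs; rewrite -(graded_fibers gA (etrans e1 (esym s1E))) ee.
by rewrite (graded_fibers gB (etrans e2 (esym s2E))).
Qed.

End FiberProduct.
(** Stated for an arbitrary property of rows, to serve both for kernels and for equality of
    columns. *)
Lemma stack_rowsP N (k : nat -> nat) (B : forall r, 'M[int]_(k r, N)) r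
    (Q : 'rV[int]_N -> Prop) :
  (forall i, Q (row i (stack B r))) <->
  (forall q, (q <= r)%N -> forall l, Q (row l (B q))).
Proof.
elim: r => [|r IH].
  by split=> [H q|H]; [rewrite leqn0 => /eqP->|exact: H].
split=> [H q|H i ]; last first.
  case: (split_ordP i) => l ->.
    by rewrite /= rowKu; apply: (IH.2 _ l) => q qr; apply: H; exact: leqW.
  by rewrite /= rowKd; exact: H.
rewrite leq_eqVlt => /orP[/eqP->|qr] l.
  by have := H (rshift _ l); rewrite /= rowKd.
by move: q qr l; apply/IH => i; have := H (lshift _ i); rewrite /= rowKu.
Qed.

(** * Matrices attached to a labeling *)

Section Realization.
Variables (m n : nat) (S : {set 'I_m * 'I_n}).
Local Notation ev := (enum_val : 'I_#|S| -> 'I_m * 'I_n).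

Definition label_count (b : 'I_m * 'I_n -> nat) : nat := (\max_(s in S) b s).+1.

Definition label_mx (b : 'I_m * 'I_n -> nat) : 'M[int]_(label_count b, #|S|) :=
  \matrix_(l, s) (b (ev s) == l)%:R.

Lemma label_lt b s : (b (ev s) < label_count b)%N.
Proof. by rewrite ltnS; apply: (leq_bigmax_cond (F := b)); exact: enum_valP. Qed.

Lemma label_partition b : partition_mx (label_mx b).
Proof.
split=> [l s|s]; first by rewrite mxE; case: eqP; [right|left].
rewrite (_ : [set l | _] = [set Ordinal (label_lt b s)]) ?cards1 //.
apply/setP=> l; rewrite !inE mxE -val_eqE /= eq_sym.
by case: (eqVneq (l : nat) (b (ev s))).
Qed.

Lemma label_col_eq b s t : (col t (label_mx b) == col s (label_mx b)) = (b (ev t) == b (ev s)).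
Proof.
apply/eqP/eqP => [/colP/(_ (Ordinal (label_lt b s)))|E].
  by rewrite !mxE /= eqxx; case: eqP.
by apply/colP=> l; rewrite !mxE E.
Qed.

(** Transports a vector from column indices to cells, with value 0 outside [S]. *)
Definition cell_fun (w : 'I_#|S| -> int) (c : 'I_m * 'I_n) : int := \sum_(s | ev s == c) w s.

Lemma cell_funE w s : cell_fun w (ev s) = w s.
Proof.
by rewrite /cell_fun (big_pred1 s) // => t; rewrite /= (inj_eq enum_val_inj).
Qed.

Lemma sum_cell_fun w (P : pred ('I_m * 'I_n)) :
  \sum_(c in S | P c) cell_fun w c = \sum_(s | P (ev s)) w s.
Proof.
rewrite (big_enum_val_cond (A := mem S) P (cell_fun w)).
by apply: eq_bigr => s _; exact: cell_funE.
Qed.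

Lemma label_null b w :
  (forall l, \sum_s label_mx b l s * w s = 0) <-> null_on S b (cell_fun w).
Proof.
have sumE l : \sum_s label_mx b l s * w s = \sum_(s | b (ev s) == l) w s.
  rewrite [RHS]big_mkcond; apply: eq_bigr => s _; rewrite mxE.
  by case: eqP; rewrite ?mul1r ?mul0r.
split=> [H l|H l]; last by rewrite sumE -(sum_cell_fun w (fun c => b c == l)) H.
rewrite (sum_cell_fun w (fun c => b c == l)).
have [lb|lb] := ltnP l (label_count b); first by rewrite -[RHS](H (Ordinal lb)) sumE.
rewrite big_pred0 // => s; apply/negP => /eqP sl.
by have := label_lt b s; rewrite sl ltnNge lb.
Qed.

Variables (h : nat) (b g : nat -> 'I_m * 'I_n -> nat).
Hypothesis data : tfp_data S h b g.

Let B r := label_mx (b r).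

Lemma stack_null r w : (forall i, \sum_s stack B r i s * w s = 0) <->
  (forall q, (q <= r)%N -> null_on S (b q) (cell_fun w)).
Proof.
have rowE d (M : 'M[int]_(d, #|S|)) i :
    \sum_s (row i M) 0 s * w s = \sum_s M i s * w s.
  by apply: eq_bigr => s _; rewrite mxE.
have [E1 E2] := stack_rowsP B r (fun v => \sum_s v 0 s * w s = 0).
split=> [H q qr|H i ].
  by apply/label_null => l; rewrite -rowE; apply: E1 => // i; rewrite rowE.
by rewrite -rowE; apply: E2 => q qr l; rewrite rowE; apply/label_null: l; exact: H.
Qed.

Lemma stack_col_eq r s t :
  (col t (stack B r) == col s (stack B r)) = same_prefix b r (ev s) (ev t).
Proof.
have := stack_rowsP B r (fun v => v 0 t = v 0 s) => -[E1 E2].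
apply/eqP/same_prefixP => [/colP H q qr|H].
  apply/eqP; rewrite -label_col_eq; apply/eqP/colP => l; rewrite !mxE.
  have := E1 _ q qr l; rewrite !mxE; apply => i; rewrite !mxE.
  by have := H i; rewrite !mxE.
apply/colP => i; rewrite !mxE; have := E2 _ i; rewrite !mxE; apply => q qr l.
by rewrite !mxE H.
Qed.

Lemma weight1 (P : pred ('I_m * 'I_n)) :
  weight S (fun=> 1%N) (fun=> 1%N) P = mult (fun t => P (ev t)).
Proof. by rewrite /weight (big_enum_val_cond (A := mem S)). Qed.

(** [tfp_prefix] and [tfp_next] make the two factors homogeneous, and [tfp_weight] at constant
    weights 1 is the condition on multiplicities. *)
Lemma realization_iterated (C : fieldType) : iterated_TFP_linear C B h.
Proof.
move=> r rh; have [next pref _ wt] := data.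
pose c := (\max_(s in S) g r s)%N.
pose gr (s : 'I_#|S|) : 'I_c.+1 := inord (g r (ev s)).
have grE s : gr s = g r (ev s) :> nat by rewrite inordK //; exact: label_lt.
have gr_eq s t : (gr t == gr s) = (g r (ev t) == g r (ev s)) by rewrite -val_eqE /= !grE.
have gr_null w : null_on S (g r) (cell_fun w) -> forall a, \sum_(s | gr s == a) w s = 0.
  move=> H a; rewrite -[RHS](H a) (sum_cell_fun w (fun c => g r c == a)).
  by apply: eq_bigl => s; rewrite -val_eqE /= grE.
have [||s s' gs|M [M' [X [Y [gX [gY XY]]]]]] :=
    fiber_product_exists C (A := stack B r) (B := B r.+1) (g := gr).
- by move=> w /stack_null wA; apply/gr_null/pref.
- by move=> w /label_null wB; apply/gr_null/next.
- have {}gs : g r (ev s) = g r (ev s') by rewrite -!grE gs.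
  have := wt r (fun=> 1%N) (fun=> 1%N) _ _ rh (enum_valP s) (enum_valP s') gs.
  rewrite !weight1 => E; etransitivity; [|etransitivity; [exact: E|]];
    by congr (_ * _)%N; apply: eq_bigl => t; rewrite ?stack_col_eq ?label_col_eq ?gr_eq.
by exists M, M', c.+1, X, Y, gX, gY.
Qed.

(** Both ideals are generated by the binomials of a kernel, and [tfp_kernel] identifies the two
    kernels. *)
Lemma realization_toric (C : fieldType) f :
  toric_ideal C (quasi_independence_mx S) f <-> toric_ideal C (stack B h) f.
Proof.
have [_ _ ker _] := data.
have kerE (u v : 'X_{1..#|S|}) :
    (forall i, \sum_s quasi_independence_mx S i s * ((u s)%:Z - (v s)%:Z) = 0) <->
    (forall i, \sum_s stack B h i s * ((u s)%:Z - (v s)%:Z) = 0).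
  set w := fun s => (u s)%:Z - (v s)%:Z.
  have E1 : (forall i, \sum_s quasi_independence_mx S i s * w s = 0) <->
      null_margins S (cell_fun w).
    have := qi_kernelP w => E; split=> [H|[r c] k].
      have [|r c] := E.1.
        by move=> k; rewrite -[RHS](H k); apply: eq_bigr => s _; rewrite intz.
      by split=> k; [rewrite (sum_cell_fun w (fun c => c.1 == k))|
        rewrite (sum_cell_fun w (fun c => c.2 == k))]; [exact: r|exact: c].
    rewrite -[RHS](E.2 _ k); first by apply: eq_bigr => s _; rewrite intz.
    split=> l; [rewrite -[RHS](r l) (sum_cell_fun w (fun c => c.1 == l))|
      rewrite -[RHS](c l) (sum_cell_fun w (fun c => c.2 == l))] => //.
  by rewrite E1 -ker -stack_null.
by split=> -[l [lG ->]]; exists l; split=> // q /lG[u [v [uv qE]]]; exists u, v; split=> //;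
  apply/kerE.
Qed.

End Realization.

(** * The three-block matrix for the coordinate toric fiber product *)

Section CoordinateTFP.
Variables (m n : nat) (S : {set 'I_m * 'I_n}).

Definition two_way_rows (r : nat) : nat :=
  match r with 0 => 1 | 1 => m | _ => n end.

(** The constant block has a single label and makes the row coordinate internal. *)
Definition two_way_block (r : nat) : 'M[int]_(two_way_rows r, #|S|) :=
  match r return 'M[int]_(two_way_rows r, #|S|) with
  | 0 => const_mx 1
  | 1 => \matrix_(i, s) ((enum_val s).1 == i)%:R
  | _ => \matrix_(j, s) ((enum_val s).2 == j)%:R
  end.

Lemma two_way_multipartition : multipartition two_way_block 2.
Proof.
have part k (f : 'I_#|S| -> 'I_k) :
    partition_mx (\matrix_(i < k, s < #|S|) (f s == i)%:R).
  split=> [i s|s]; first by rewrite mxE; case: eqP; [right|left].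
  rewrite (_ : [set i | _] = [set f s]) ?cards1 //.
  by apply/setP=> i; rewrite !inE mxE [in RHS]eq_sym; case: (f s == i).
case=> [|[|[|r]]] // _; [|exact: part|exact: part].
split=> [i s|s]; first by right; rewrite mxE.
by rewrite (_ : [set i | _] = setT) ?cardsT ?card_ord //; apply/setP=> i; rewrite !inE mxE eqxx.
Qed.

Lemma two_way_row_span (R : fieldType) :
  same_row_span R (stack two_way_block 2) (quasi_independence_mx S).
Proof.
rewrite /same_row_span /quasi_independence_mx /= !map_col_mx.
set r := map_mx intr (\matrix_(i, s) _); set c := map_mx intr (\matrix_(j, s) _).
(* The constant row is the sum of the rows of the row block. *)
have ones : (map_mx intr (const_mx 1 : 'M[int]_(1, #|S|)) <= r)%MS.
  apply/submxP; exists (const_mx 1 : 'M[R]_(1, m)).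
  apply/matrixP=> i s; rewrite !mxE (bigD1 (enum_val s).1) //= !mxE eqxx mulr1.
  by rewrite big1 ?addr0 // => k /negPf; rewrite !mxE eq_sym => ->; rewrite mulr0.
apply/eqmxP; rewrite -!addsmxE; apply/andP; split.
  apply: addsmxS => //; rewrite col_mx_sub ones submx_refl //.
by apply: addsmxS => //; rewrite -addsmxE addsmxSr.
Qed.

(** The coordinate 0 takes a single value, so the cell that realizes the final part [d] already
    realizes the whole concatenation. *)
Lemma two_way_cTFP (r : 'I_3) : internal r -> cTFP two_way_block r.
Proof.
move=> r1 t; have {}r1 : r = 1%N :> nat by move: r1; rewrite /internal; case: (r : nat) => [|[|]].
split=> [ct|[c [d [_ [s ds] _ _ td]]]]; first by exists t, t; split.
exists s => q; have [q0|rq] := leqP r q; first by rewrite td.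
by case: q rq {td} => [[|q] ltq]; rewrite r1 // => _; rewrite mxE.
Qed.

End CoordinateTFP.
Theorem theorem1p1 (R : realType) (m n : nat) (S : {set 'I_m * 'I_n})
    (mleS : ml_degree R[i] (quasi_independence_mx S) 1) :
  (exists (h : nat) (k : nat -> nat) (B : forall r, 'M[int]_(k r, #|S|)),
     [/\ (1 < h)%N,
         multipartition B h,
         same_row_span R (stack B h) (quasi_independence_mx S) &
         forall r : 'I_h.+1, internal r -> cTFP B r]) /\
  (exists (h : nat) (k : nat -> nat) (B : forall r, 'M[int]_(k r, #|S|)),
     [/\ multipartition B h,
         iterated_TFP_linear R[i] B h &
         forall f : {mpoly R[i][#|S|]},
           toric_ideal R[i] (quasi_independence_mx S) f <->
           toric_ideal R[i] (stack B h) f]).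
Proof.
split.
  exists 2%N, (two_way_rows m n), (two_way_block S); split=> //.
  - exact: two_way_multipartition.
  - exact: two_way_row_span.
  - exact: two_way_cTFP.
have exS : exchange (row_cols S).
  by move=> i0 K i1 i2 a; exact: (ml_degree1_exchange mleS).
have [h [b [g data]]] := exchange_tfp exS.
exists h, (fun r => label_count S (b r)), (fun r => label_mx S (b r)); split.
- by move=> r _; exact: label_partition.
- exact: realization_iterated data _.
- exact: realization_toric data _.
Qed.
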